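(* Let $B$ be a complex Banach space. The space $\Sigma(B)$ of exponentially decreasing sequences in $B$ is isomorphic to the space $\mathrm{Hol}(\mathbb C,B)$ of $B$-valued holomorphic functions.
   Context: A sequence $(f_k)_{k\ge0}$ of elements of a Banach space $B$ is called exponentially decreasing if $\sum_k\|f_k\|_B\,e^{kn}<\infty$ for all $n\in\mathbb N$. $\Sigma(B)$ denotes the space of all such sequences; each of the two families of norms $\|f\|_{l_1^n}=\sum_{k\ge0}e^{nk}\|f_k\|_B$ and $\|f\|_{l_\infty^n}=\sup_{k\ge 0}e^{nk}\|f_k\|_B$ defines a grading on it (an increasing sequence of seminorms defining the topology). $\mathrm{Hol}(\mathbb C,B)$ denotes the space of holomorphic functions $\mathbb C\to B$. *)

(* Defs.v *)
From HB Require Import structures.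
From mathcomp Require Import all_boot all_order all_algebra.
From mathcomp Require Import all_classical all_reals all_analysis.
From mathcomp Require Import complex.

Set Implicit Arguments.
Unset Strict Implicit.
Unset Printing Implicit Defensive.

Import Order.TTheory GRing.Theory Num.Theory.
Import numFieldNormedType.Exports.
Local Open Scope classical_set_scope.
Local Open Scope ring_scope.

Definition linear_homeomorphic (K : numDomainType)
    (E F : preTopologicalLmodType K) : Prop :=
  exists (f : {linear E -> F}) (g : {linear F -> E}),
    [/\ cancel f g, cancel g f, continuous f & continuous g].

Section ComplexBanach.
Variables (R : realType) (B : completeNormedModType R[i]).

(* The norm of [B] takes its values in [R[i]], where [0 <= z] implies that [z]
   is real: taking the real part loses nothing. *)
Definition rnorm (x : B) : R := complex.Re `|x|.

Lemma rnormE (x : B) : `|x| = (rnorm x)%:C%C.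
Proof.
rewrite /rnorm; have := normr_ge0 x.
by case: `|x| => a b; rewrite lecE /= => /andP[/eqP -> _].
Qed.

Lemma rnorm_ge0 (x : B) : 0 <= rnorm x.
Proof. by rewrite -lecR -rnormE normr_ge0. Qed.

Lemma rnorm0 : rnorm 0 = 0.
Proof. by rewrite /rnorm normr0. Qed.

Lemma ler_rnormD (x y : B) : rnorm (x + y) <= rnorm x + rnorm y.
Proof. by rewrite -lecR rmorphD /= -!rnormE ler_normD. Qed.

Lemma rnormZ (a : R[i]) (x : B) : rnorm (a *: x) = complex.Re `|a| * rnorm x.
Proof.
rewrite /rnorm normrZ rnormE; case: `|a| => u v /=.
by rewrite mulr0 subr0.
Qed.

Definition l1_term (n : nat) (f : nat -> B) (k : nat) : R :=
  expR (n * k)%N%:R * rnorm (f k).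

Definition exp_decreasing : {pred nat -> B} :=
  [in [set f | forall n : nat, cvgn (series (l1_term n f))]].

Definition l1_norm (n : nat) (f : nat -> B) : R := limn (series (l1_term n f)).

Lemma l1_term_ge0 n f k : 0 <= l1_term n f k.
Proof. by rewrite mulr_ge0 ?expR_ge0 ?rnorm_ge0. Qed.

Lemma l1_termD n f g k : l1_term n (f + g) k <= l1_term n f k + l1_term n g k.
Proof. by rewrite -mulrDr ler_wpM2l ?expR_ge0 // ler_rnormD. Qed.

Lemma is_cvg_l1D n f g :
  cvgn (series (l1_term n f)) -> cvgn (series (l1_term n g)) ->
  cvgn (series (l1_term n f + l1_term n g)).
Proof. by move=> cf cg; rewrite seriesD; exact: is_cvgD. Qed.

Lemma exp_decreasing_submod_closed : submod_closed exp_decreasing.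
Proof.
split.
  apply/mem_set => n; have -> : l1_term n 0 = cst 0.
    by apply/funext => k; rewrite /l1_term rnorm0 mulr0.
  apply: (cvgP (0 : R)); have -> : series (cst 0 : R^nat) = cst 0.
    by apply/funext => m; rewrite /series /= big1.
  exact: cvg_cst.
move=> a f g /set_mem fS /set_mem gS; apply/mem_set => n.
have caf : cvgn (series (l1_term n (a *: f))).
  have -> : l1_term n (a *: f) = (complex.Re `|a|) *: l1_term n f.
    apply/funext => k.
    by rewrite /l1_term /= rnormZ mulrCA.
  exact: is_cvg_seriesZ.
apply: (series_le_cvg (l1_term_ge0 _ _) _ (@l1_termD n _ _)).
  by move=> k; rewrite addr_ge0 ?l1_term_ge0.
exact: is_cvg_l1D.
Qed.

HB.instance Definition _ := GRing.isSubmodClosed.Build _ _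
  exp_decreasing exp_decreasing_submod_closed.

Record Sigma := MkSigma {
  Sigma_fun :> nat -> B;
  Sigma_in : Sigma_fun \in exp_decreasing }.

HB.instance Definition _ := [isSub for Sigma_fun].
HB.instance Definition _ := [Choice of Sigma by <:].
HB.instance Definition _ := [SubChoice_isSubLmodule of Sigma by <:].

Lemma SigmaP (f : Sigma) n : cvgn (series (l1_term n f)).
Proof. by move: n; exact: (set_mem (Sigma_in f)). Qed.

Lemma l1_norm0 n : l1_norm n 0 = 0.
Proof.
rewrite /l1_norm; have -> : series (l1_term n 0) = cst 0.
  apply/funext => m; rewrite /series /= big1 // => k _.
  by rewrite /l1_term rnorm0 mulr0.
exact: lim_cst.
Qed.

Lemma ler_l1_normD n (f g : Sigma) :
  l1_norm n (f + g : Sigma) <= l1_norm n f + l1_norm n g.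
Proof.
rewrite /l1_norm -limD; [|exact: SigmaP|exact: SigmaP].
rewrite -seriesD; apply: ler_lim; first exact: SigmaP.
  by apply: is_cvg_l1D; exact: SigmaP.
by apply: nearW => m; apply: ler_sum => k _; exact: l1_termD.
Qed.

Lemma l1_norm_mono (f : Sigma) n m : (n <= m)%N -> l1_norm n f <= l1_norm m f.
Proof.
move=> nm; apply: ler_lim; [exact: SigmaP|exact: SigmaP|].
apply: nearW => j; apply: ler_sum => k _.
by rewrite ler_wpM2r ?rnorm_ge0 // ler_expR ler_nat leq_mul2r nm orbT.
Qed.

Definition Sigma_ball (f : Sigma) (n : nat) (e : R) : set Sigma :=
  [set g : Sigma | l1_norm n (g - f : Sigma) < e].

Lemma Sigma_ball_center f n e : 0 < e -> Sigma_ball f n e f.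
Proof. by move=> e0; rewrite /Sigma_ball /mkset subrr l1_norm0. Qed.

Lemma Sigma_ball_sub f n m d e : (n <= m)%N -> e <= d ->
  Sigma_ball f m e `<=` Sigma_ball f n d.
Proof.
move=> nm ed g; rewrite /Sigma_ball /mkset => ge.
by apply: lt_le_trans ed; apply: le_lt_trans ge; apply: l1_norm_mono.
Qed.

(* As the norms [l1_norm n] increase with [n], their open balls form a
   neighbourhood base. *)
Definition Sigma_nbhs (f : Sigma) : set_system Sigma :=
  filter_from [set p : nat * R | 0 < p.2] (fun p => Sigma_ball f p.1 p.2).

Lemma Sigma_nbhs_filter (f : Sigma) : ProperFilter (Sigma_nbhs f).
Proof.
apply: filter_from_proper; last first.
  by move=> [n e] e0; exists f; exact: Sigma_ball_center.
apply: filter_from_filter; first by exists (0%N, 1); exact: ltr01.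
move=> [n d] [m e] d0 e0; exists (maxn n m, Num.min d e).
  by rewrite /mkset /snd lt_min d0.
move=> g fg; split; apply: Sigma_ball_sub fg;
  by rewrite ?leq_maxl ?leq_maxr ?ge_min ?lexx ?orbT.
Qed.

Lemma Sigma_nbhs_singleton (f : Sigma) (A : set Sigma) : Sigma_nbhs f A -> A f.
Proof. by move=> [[n e] e0]; apply; exact: Sigma_ball_center. Qed.

Lemma Sigma_nbhs_nbhs (f : Sigma) (A : set Sigma) :
  Sigma_nbhs f A -> Sigma_nbhs f (Sigma_nbhs^~ A).
Proof.
move=> [[n e] e0 sA]; exists (n, e) => // g fg.
exists (n, e - l1_norm n (g - f : Sigma)); first by rewrite /mkset /snd subr_gt0.
move=> h gh; apply: sA; rewrite /Sigma_ball /mkset /fst /snd.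
have -> : h - f = (h - g) + (g - f) by rewrite subrKA.
apply: le_lt_trans (ler_l1_normD _ _ _) _; rewrite -ltrBrDr.
exact: gh.
Qed.

HB.instance Definition _ := hasNbhs.Build Sigma Sigma_nbhs.
HB.instance Definition _ := Nbhs_isNbhsTopological.Build Sigma
  Sigma_nbhs_filter Sigma_nbhs_singleton Sigma_nbhs_nbhs.

(* Over the field [R[i]], derivability in direction 1 is the existence of the
   limit of [h^-1 *: (f (z + h) - f z)] as the complex [h != 0] tends to 0. *)
Definition holomorphic : {pred R[i]^o -> B} :=
  [in [set f : R[i]^o -> B | forall z, derivable f z 1]].

Lemma holomorphic_submod_closed : submod_closed holomorphic.
Proof.
split; first by apply/mem_set => z; exact: derivable_cst.
move=> a f g /set_mem fH /set_mem gH; apply/mem_set => z.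
by apply: derivableD => //; exact: derivableZ.
Qed.

HB.instance Definition _ := GRing.isSubmodClosed.Build _ _
  holomorphic holomorphic_submod_closed.

Record Hol := MkHol {
  Hol_fun :> R[i]^o -> B;
  Hol_in : Hol_fun \in holomorphic }.

HB.instance Definition _ := [isSub for Hol_fun].
HB.instance Definition _ := [Choice of Hol by <:].
HB.instance Definition _ := [SubChoice_isSubLmodule of Hol by <:].

(* The usual Frechet topology, that of uniform convergence on compact sets. *)
HB.instance Definition _ := Topological.copy Hol
  (initial_topology (Hol_fun : Hol -> {family compact, R[i]^o -> B})).

End ComplexBanach.

(* Main.v *)
Require Import Defs.
From HB Require Import structures.
From mathcomp Require Import all_boot all_order all_algebra.
From mathcomp Require Import all_classical all_reals all_analysis.
From mathcomp Require Import complex ring lra.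

(** The isomorphism sends a sequence to the sum of its power series. Its inverse
    reads off Taylor coefficients, as integrals of [f z / z ^+ k.+1] over the
    boundaries of the squares of half side [2 ^+ j] centred at [0].

    Integrals are limits of dyadic midpoint sums, which are exactly additive when
    a square is cut into four. Hence Goursat's theorem is a bisection argument,
    and doubling the contour adds twelve small squares avoiding [0], whose sums
    tend to [0]. So the coefficients do not depend on [j], which yields their
    exponential decay. Goursat's theorem also holds if [f] is merely
    continuous at one point; applied to [(f z - f w) / (z - w)], together with
    the expansion of [1 / (z - w)] in powers of [w / z], it gives the Taylor
    expansion at [w]. No value of [2 * pi * 'i] is needed: it suffices that the
    integral of [1 / z] is nonzero. *)

Set Implicit Arguments.
Unset Strict Implicit.
Unset Printing Implicit Defensive.

Import Order.TTheory GRing.Theory Num.Theory.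
Import numFieldNormedType.Exports.
Local Open Scope classical_set_scope.
Local Open Scope ring_scope.

(** * The complex plane *)

Section ComplexNorm.
Variable R : realType.
Implicit Types (z w : R[i]) (e : R).

Definition cabs z : R := complex.Re `|z|.

Lemma cabsE z : `|z| = (cabs z)%:C%C.
Proof.
rewrite /cabs; have := normr_ge0 z.
by case: `|z| => a b; rewrite lecE /= => /andP[/eqP -> _].
Qed.

Lemma cabs_ge0 z : 0 <= cabs z.
Proof. by rewrite -lecR -cabsE normr_ge0. Qed.

Lemma cabsM z w : cabs (z * w) = cabs z * cabs w.
Proof. by apply: complexI; rewrite rmorphM /= -!cabsE normrM. Qed.

Lemma cabs1 : cabs 1 = 1.
Proof. by apply: complexI; rewrite -cabsE normr1. Qed.

Lemma cabs0 : cabs 0 = 0.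
Proof. by apply: complexI; rewrite -cabsE normr0. Qed.

Lemma cabsB z w : cabs (z - w) = cabs (w - z).
Proof. by rewrite /cabs distrC. Qed.

Lemma cabsX z n : cabs (z ^+ n) = cabs z ^+ n.
Proof. by apply: complexI; rewrite rmorphXn /= -!cabsE normrX. Qed.

Lemma cabsV z : cabs z^-1 = (cabs z)^-1.
Proof. by apply: complexI; rewrite fmorphV /= -!cabsE normfV. Qed.

Lemma cabsC (x : R) : 0 <= x -> cabs x%:C%C = x.
Proof. by move=> x0; apply: complexI; rewrite -cabsE ger0_norm // ler0c. Qed.

Lemma cabs_nat n : cabs n%:R = n%:R.
Proof. by apply: complexI; rewrite -cabsE normr_nat rmorph_nat. Qed.

Lemma cabsi : cabs 'i%C = 1.
Proof. by rewrite /cabs /= expr0n expr1n add0r sqrtr1. Qed.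

Lemma cabs_eq0 z : (cabs z == 0) = (z == 0).
Proof. by rewrite -(inj_eq (@complexI R)) -cabsE normr_eq0. Qed.

Lemma cabs_gt0 z : (0 < cabs z) = (z != 0).
Proof. by rewrite lt_def cabs_eq0 cabs_ge0 andbT. Qed.

Lemma ler_cabsD z w : cabs (z + w) <= cabs z + cabs w.
Proof. by rewrite -lecR rmorphD /= -!cabsE ler_normD. Qed.

Lemma ler_Re z : `|complex.Re z| <= cabs z.
Proof. by rewrite -lecR -cabsE normc_ge_Re. Qed.

Lemma ler_Im z : `|complex.Im z| <= cabs z.
Proof.
have := ler_Re (z * 'i%C).
by rewrite ReiNIm normrN cabsM cabsi mulr1.
Qed.

Lemma ler_cabs_ReIm z : cabs z <= `|complex.Re z| + `|complex.Im z|.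
Proof.
rewrite {1}(complexE z); apply: le_trans (ler_cabsD _ _) _.
rewrite cabsM cabsi mul1r -lecR !rmorphD /=.
rewrite -!cabsE. 
by rewrite !normc_def /= expr0n /= !addr0 !sqrtr_sqr.
Qed.

(** A positive element of [R[i]] is real, so the complex radii of balls can be traded for real
    ones. *)
Lemma nbhs_cabs (z : R[i]^o) (P : set R[i]^o) :
  nbhs z P <-> exists2 e : R, 0 < e & forall w, cabs (w - z) < e -> P w.
Proof.
split=> [/nbhs_ballP[e /= e0 eP]|[e e0 eP]].
  exists (complex.Re e); first by move: e0; rewrite ltcE => /andP[].
  move=> w wz; apply: eP; rewrite -ball_normE /= distrC cabsE.
  by rewrite -[ltRHS]RRe_real ?gtr0_real// ltcR.
apply/nbhs_ballP; exists (e%:C)%C; first by rewrite /= ltcR.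
by move=> w; rewrite -ball_normE /= distrC cabsE ltcR; exact: eP.
Qed.

(** Real and imaginary parts do not increase distances, so they send a Cauchy filter to Cauchy
    filters on [R]; the two limits are the coordinates of the complex one. *)
Lemma complex_cauchy_cvg (F : set_system R[i]^o) :
  ProperFilter F -> cauchy F -> cvg F.
Proof.
move=> FF /cauchy_ballP Fc.
have part (p : R[i] -> R) : (forall z w, p (z - w) = p z - p w) ->
    (forall z, `|p z| <= cabs z) -> cvg ((p : R[i]^o -> R^o) @ F).
  move=> pB ple; apply/cauchy_cvgP/cauchy_ballP => e e0.
  have e0' : 0 < (e%:C)%C by rewrite ltcR.
  have [[A B] [/= FA FB] AB] := Fc _ e0'.
  exists (p @` A, p @` B) => /=.
    by split; [apply: filterS FA|apply: filterS FB] => z Az; exists z.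
  move=> [_ _] [/= [z Az <-] [w Bw <-]].
  have := AB (z, w) (conj Az Bw).
  rewrite -!ball_normE /= cabsE ltcR => zw.
  by rewrite -pB; exact: le_lt_trans (ple _) zw.
have /part-/(_ ler_Re)/cvg_ex[a Fa] : forall z w, complex.Re (z - w) = complex.Re z - complex.Re w.
  by move=> [? ?] [? ?].
have /part-/(_ ler_Im)/cvg_ex[b Fb] : forall z w, complex.Im (z - w) = complex.Im z - complex.Im w.
  by move=> [? ?] [? ?].
apply/cvg_ex; exists (a +i* b)%C.
apply/fcvgrPdist_lt => e; rewrite ltcE => /andP[/eqP Ie Re0].
have e2 : 0 < complex.Re e / 2 by rewrite divr_gt0.
move/cvgrPdist_lt: Fa => /(_ _ e2) Fa.
move/cvgrPdist_lt: Fb => /(_ _ e2) Fb.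
near=> z; rewrite cabsE [e]complexE Ie mulr0 addr0 ltcR.
apply: le_lt_trans (ler_cabs_ReIm _) _.
rewrite [ltRHS]splitr.
have -> : complex.Re ((a +i* b)%C - z) = a - complex.Re z by case: (z).
have -> : complex.Im ((a +i* b)%C - z) = b - complex.Im z by case: (z).
by apply: ltrD; near: z.
Unshelve. all: by end_near. Qed.

End ComplexNorm.
(* The library makes [K^o] complete for [K] a [realType] only; that canonical
   instance keeps [R[i]^o] from getting one of its own. *)
Definition complex_banach (R : realType) : Type := R[i].

Section ComplexBanachSpace.
Variable R : realType.
HB.instance Definition _ := NormedModule.copy (complex_banach R) R[i]^o.
HB.instance Definition _ := Uniform_isComplete.Build (complex_banach R) (@complex_cauchy_cvg R).
End ComplexBanachSpace.

(** * Bisection *)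

Lemma exprVn_double (R : numFieldType) n :
  2^-1 ^+ n = 2^-1 ^+ n.+1 + 2^-1 ^+ n.+1 :> R.
Proof. by rewrite exprS; field. Qed.

(** The intervals from [u n] to [u n + 2^-1 ^+ n] are nested, so the limit of their left ends lies
    in all of them. *)
Lemma dyadic_nested (R : realType) (u : R^nat) :
  (forall n, u n <= u n.+1 <= u n + 2^-1 ^+ n.+1) ->
  exists l, forall n, u n <= l <= u n + 2^-1 ^+ n.
Proof.
move=> u_step.
have nd : nondecreasing_seq u by apply/nondecreasing_seqP => n; case/andP: (u_step n).
have ni : nonincreasing_seq (fun n => u n + 2^-1 ^+ n).
  apply/nonincreasing_seqP => n; case/andP: (u_step n) => _ h.
  by rewrite [leRHS](_ : _ = u n + 2^-1 ^+ n.+1 + 2^-1 ^+ n.+1) ?lerD2r// -addrA -exprVn_double.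
have ub n m : u m <= u n + 2^-1 ^+ n.
  apply: (le_trans (nd _ _ (leq_maxl m n))).
  by apply: (le_trans _ (ni _ _ (leq_maxr m n))); rewrite lerDl exprn_ge0.
have cu : cvgn u.
  by apply: (nondecreasing_is_cvgn nd); exists (u 0 + 1) => _ [m _ <-]; have := ub 0%N m; rewrite expr0.
exists (limn u) => n; rewrite (nondecreasing_cvgn_le nd cu) /=.
by apply: limr_le => //; apply: nearW.
Qed.

(* [P n x y] is a property of the square with corner [(x, y)] and side [2^-n]. *)
Lemma dyadic_cousin (R : realType) (P : nat -> R -> R -> Prop) :
  (forall n (x y : R) (h := 2^-1 ^+ n.+1),
    P n.+1 x y -> P n.+1 (x + h) y ->
    P n.+1 x (y + h) -> P n.+1 (x + h) (y + h) -> P n x y) ->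
  (forall x0 y0 : R, 0 <= x0 <= 1 -> 0 <= y0 <= 1 -> exists N, forall n (x y : R),
    (N <= n)%N -> x <= x0 <= x + 2^-1 ^+ n -> y <= y0 <= y + 2^-1 ^+ n ->
    P n x y) ->
  P 0%N 0 0.
Proof.
move=> P_glue P_loc; apply: contrapT => nP0.
(* [c] selects in each bad square a bad quarter, by gluing. Iterating it in [s] gives nested bad
   squares, whose common point contradicts [P_loc]. *)
have /choice[c cP] (t : nat * R * R) : exists b : bool * bool,
    ~ P t.1.1 t.1.2 t.2 -> ~ P t.1.1.+1 (t.1.2 + b.1%:R * 2^-1 ^+ t.1.1.+1)
                                (t.2 + b.2%:R * 2^-1 ^+ t.1.1.+1).
  case: t => -[n x] y /=.
  have [//|H] := pselect (exists b : bool * bool,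
    ~ P n x y -> ~ P n.+1 (x + b.1%:R * 2^-1 ^+ n.+1)
                          (y + b.2%:R * 2^-1 ^+ n.+1)).
  have {}H (b : bool * bool) : P n.+1 (x + b.1%:R * 2^-1 ^+ n.+1)
                                      (y + b.2%:R * 2^-1 ^+ n.+1).
    by apply: contrapT => nP; apply: H; exists b.
  exists (false, false) => nP; exfalso; apply: nP; apply: P_glue.
  - by have := H (false, false); rewrite /= !mul0r !addr0.
  - by have := H (true, false); rewrite /= !mul0r !mul1r !addr0.
  - by have := H (false, true); rewrite /= !mul0r !mul1r !addr0.
  - by have := H (true, true); rewrite /= !mul1r.
pose s := fix s n : R * R := if n is m.+1 then
   let b := c (m, (s m).1, (s m).2) in
   ((s m).1 + b.1%:R * 2^-1 ^+ m.+1, (s m).2 + b.2%:R * 2^-1 ^+ m.+1)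
  else (0, 0).
have sP n : ~ P n (s n).1 (s n).2.
  by elim: n => [//|n IH]; exact: (cP (n, (s n).1, (s n).2)).
have bE (b : bool) n : 0 <= (b%:R * 2^-1 ^+ n.+1 : R) <= 2^-1 ^+ n.+1.
  by rewrite mulr_ge0 ?exprn_ge0//=; case: b; rewrite ?mul1r ?mul0r ?exprn_ge0.
have [|x0 x0P] := @dyadic_nested R (fun n => (s n).1).
  by move=> n /=; rewrite lerDl lerD2l bE.
have [|y0 y0P] := @dyadic_nested R (fun n => (s n).2).
  by move=> n /=; rewrite lerDl lerD2l bE.
have [||N /(_ N _ _ (leqnn _) (x0P N) (y0P N))/sP//] := P_loc x0 y0.
- by have := x0P 0%N; rewrite /= add0r.
- by have := y0P 0%N; rewrite /= add0r.
Qed.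

(** * Limits, continuity and derivatives in terms of the real-valued norm *)

Section RealNorm.
Variables (R : realType) (B : completeNormedModType R[i]).
Implicit Types (x y : B) (e : R).

Lemma rnormN x : rnorm (- x) = rnorm x.
Proof. by rewrite /rnorm normrN. Qed.

Lemma rnormB x y : rnorm (x - y) = rnorm (y - x).
Proof. by rewrite /rnorm distrC. Qed.

Lemma rnorm_scale (a : R[i]) x : rnorm (a *: x) = cabs a * rnorm x.
Proof. exact: rnormZ. Qed.

Lemma ler_rnormB x y : rnorm (x - y) <= rnorm x + rnorm y.
Proof. by rewrite -(rnormN y) ler_rnormD. Qed.

Lemma rnorm_eq0 x : (rnorm x == 0) = (x == 0).
Proof. by rewrite -(inj_eq (@complexI R)) -rnormE normr_eq0. Qed.

Lemma rnorm_small x : (forall e, 0 < e -> rnorm x <= e) -> x = 0.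
Proof.
move=> h; apply/eqP; rewrite -rnorm_eq0 eq_le rnorm_ge0 andbT.
by apply/ler_addgt0Pr => e /h; rewrite add0r.
Qed.

Lemma ler_rnorm_sum (I : Type) (r : seq I) (P : pred I) (f : I -> B) :
  rnorm (\sum_(i <- r | P i) f i) <= \sum_(i <- r | P i) rnorm (f i).
Proof.
elim/big_ind2: _ => [||//]; first by rewrite rnorm0.
by move=> x a y b xa yb; apply: le_trans (ler_rnormD _ _) (lerD _ _).
Qed.

Lemma cvg_rnorm {T : Type} {F : set_system T} {FF : Filter F} (f : T -> B) (l : B) :
  f @ F --> l <->
  forall e, 0 < e -> \forall t \near F, rnorm (f t - l) < e.
Proof.
rewrite cvgrPdistC_lt; split=> h e e0.
  have := h (e%:C)%C; rewrite ltcR => /(_ e0).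
  by under eq_near do rewrite rnormE ltcR.
have -> : e = (complex.Re e)%:C%C by rewrite RRe_real ?gtr0_real.
under eq_near do rewrite rnormE ltcR.
by apply: h; move: e0; rewrite ltcE => /andP[].
Qed.

Lemma cvgn_rnorm_le (u : nat -> B) (l x : B) (M : R) (N : nat) : u @ \oo --> l ->
  (forall n, (N <= n)%N -> rnorm (u n - x) <= M) -> rnorm (l - x) <= M.
Proof.
move=> /cvg_rnorm ul uM; apply/ler_addgt0Pr => e /ul[K _ Ke].
have := Ke (maxn N K) (leq_maxr _ _); have := uM (maxn N K) (leq_maxl _ _).
set v := u _ => vM vl; rewrite -(subrKA v) addrC.
by apply: le_trans (ler_rnormD _ _) (lerD _ _) => //; rewrite ltW // rnormB.
Qed.

Lemma cvgn_rnorm_bound (u : nat -> B) (l : B) (M : R) : u @ \oo --> l ->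
  (forall n, rnorm (u n) <= M) -> rnorm l <= M.
Proof.
move=> ul uM; rewrite -[l]subr0; apply: (cvgn_rnorm_le (N := 0) ul) => n _.
by rewrite subr0.
Qed.

Lemma rnorm_cauchy (u : nat -> B) :
  (forall e, 0 < e -> exists N, forall n m, (N <= n)%N -> (N <= m)%N ->
    rnorm (u n - u m) <= e) -> cvgn u.
Proof.
move=> h; apply/cauchy_cvgP/cauchy_exP => e e0.
have e0' : 0 < complex.Re e by move: e0; rewrite ltcE => /andP[].
have [|N NP] := h (complex.Re e / 2); first by rewrite divr_gt0.
exists (u N); exists N => // n /= Nn; rewrite -ball_normE /= rnormE.
rewrite -[ltRHS]RRe_real ?gtr0_real// ltcR.
by apply: le_lt_trans (NP _ _ (leqnn _) Nn) _; rewrite ltr_pdivrMr // ltr_pMr // ltrDl.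
Qed.

Lemma continuous_rnorm (g : R[i]^o -> B) (z : R[i]^o) : {for z, continuous g} <->
  forall e, 0 < e -> exists2 d : R, 0 < d &
    forall w, cabs (w - z) < d -> rnorm (g w - g z) < e.
Proof.
split=> [gz e e0|h].
  exact/nbhs_cabs/((cvg_rnorm (F := nbhs z) g (g z)).1 gz).
apply: (cvg_rnorm (F := nbhs z) g (g z)).2 => e e0.
exact/nbhs_cabs/h.
Qed.

(** Without division the estimate also covers [w = z], and it exhibits [g] as close to an affine
    function, which is what Goursat's theorem exploits. *)
Lemma derivable_rnorm (g : R[i]^o -> B) (z : R[i]^o) : derivable g z 1 ->
  exists D, forall e, 0 < e -> exists2 d : R, 0 < d &
    forall w, cabs (w - z) < d ->
      rnorm (g w - g z - (w - z) *: D) <= e * cabs (w - z).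
Proof.
move=> /cvg_ex[D /cvg_rnorm gD]; exists D => e /gD.
rewrite near_withinE => /nbhs_cabs[d d0 dP]; exists d => // w wz.
have [->|neq] := eqVneq w z.
  by rewrite !subrr scale0r subr0 rnorm0 cabs0 mulr0.
have wz0 : w - z != 0 by rewrite subr_eq0.
have := dP (w - z); rewrite subr0 => /(_ wz wz0) /=.
rewrite /= -[_ *: 1]/(_ * 1) mulr1 subrK => /ltW le.
rewrite mulrC -ler_pdivrMl ?cabs_gt0// -cabsV -rnorm_scale scalerBr.
by rewrite scalerA mulVf ?scale1r.
Qed.

Lemma derivable_continuous (g : R[i]^o -> B) (z : R[i]^o) :
  derivable g z 1 -> {for z, continuous g}.
Proof. by move=> /derivable1_diffP/differentiable_continuous. Qed.

Lemma derivable_scale (a : R[i]^o -> R[i]^o) (g : R[i]^o -> B) (z : R[i]^o) :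
  derivable a z 1 -> derivable g z 1 -> derivable (fun w => a w *: g w) z 1.
Proof.
move=> da dg; have ca : {for z, continuous a}.
  by move: da => /derivable1_diffP/differentiable_continuous.
have cz : (fun h : R[i]^o => h *: (1 : R[i]^o) + z) @ 0^' --> z.
  have : (fun h : R[i]^o => h *: (1 : R[i]^o) + z) @ 0^' --> 0 *: (1 : R[i]^o) + z.
    by apply: cvgD; [apply: cvgZr_tmp; exact: nbhs_dnbhs|exact: cvg_cst].
  by rewrite scale0r add0r.
move: da dg => /cvg_ex[A aA] /cvg_ex[D gD].
apply/cvg_ex; exists (a z *: D + A *: g z).
(* Product rule: the increment splits by inserting [a y *: g z], where [y] is the displaced
   point. *)
have -> : (fun h : R[i]^o => h^-1 *: (((fun w => a w *: g w) \o shift z) (h *: 1) - a z *: g z)) =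
  (fun h : R[i]^o => a (h *: (1 : R[i]^o) + z) *: (h^-1 *: ((g \o shift z) (h *: 1) - g z)) +
     (h^-1 *: ((a \o shift z) (h *: 1) - a z)) *: g z).
  apply/funext => h /=; set y := h *: 1 + z; rewrite -[_ *: (a y - _)]/(_ * _).
  rewrite (scalerA (a y)) (mulrC (a y)) -!scalerA -scalerDr; congr (_ *: _).
  by rewrite scalerBr scalerBl addrA subrK.
apply: cvgD.
  apply: cvgZ; last exact: gD.
  exact: cvg_comp cz ca.
apply: cvgZ; last exact: cvg_cst.
exact: aA.
Qed.

End RealNorm.

(** Bookkeeping for a square cut into four: [a], [b], [c], [e] are the halves of the bottom, right,
    top and left sides; [m] and [n] are those of the vertical and horizontal inner segments, which
    cancel. *)
Lemma quarter_rearrange (V : zmodType) (a1 a2 b1 b2 c1 c2 e1 e2 m1 m2 n1 n2 : V) :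
  (a1 + a2) + (b1 + b2) - (c1 + c2) - (e1 + e2) =
  (a1 + m1 - n1 - e1) + (a2 + b1 - n2 - m1) +
  (n1 + m2 - c1 - e2) + (n2 + b2 - c2 - m2).
Proof.
rewrite !opprD.
rewrite [RHS](AC (4*4*4*4)
  (((1*5)*(6*14)*(11*15)*(4*12))*((2*8)*(3*9)*(7*13)*(10*16)))%AC) /=.
by rewrite !(subrr, addNr) !addr0.
Qed.

(** * Contour sums *)

Section ContourSums.
Variables (R : realType) (B : completeNormedModType R[i]).
Implicit Types (g : R[i] -> B) (p d z : R[i]).
Local Notation I := ('i%C : R[i]).

(* The midpoint Riemann sum of [g] on the [2 ^ n] equal parts of the segment
   [[p, p + d]]. *)
Fixpoint segsum g n p d : B :=
  if n is m.+1 then segsum g m p (d / 2) + segsum g m (p + d / 2) (d / 2)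
  else d *: g (p + d / 2).

(* The boundary of the square with corner [p] and sides [d] and [I * d],
   counterclockwise. *)
Definition sqsum g n p d : B :=
  segsum g n p d + segsum g n (p + d) (I * d)
  - segsum g n (p + I * d) d - segsum g n p (I * d).

Definition onseg p d z := exists2 t : R, 0 <= t <= 1 & z = p + t%:C%C * d.

Definition onbdry p d z :=
  [\/ onseg p d z, onseg (p + d) (I * d) z,
      onseg (p + I * d) d z | onseg p (I * d) z].

Definition insq p d z := exists x y : R,
  [/\ 0 <= x <= 1, 0 <= y <= 1 & z = p + (x%:C%C + I * y%:C%C) * d].

Lemma onseg_half p d z : onseg p (d / 2) z -> onseg p d z.
Proof.
move=> [t t01 ->]; exists (t / 2); first by lra.
by rewrite rmorphM fmorphV rmorph_nat /=; field.
Qed.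

Lemma onseg_half2 p d z : onseg (p + d / 2) (d / 2) z -> onseg p d z.
Proof.
move=> [t t01 ->]; exists (2^-1 + t / 2); first by lra.
by rewrite rmorphD rmorphM /= fmorphV rmorph_nat /=; field.
Qed.

Lemma onseg_mid p d : onseg p d (p + d / 2).
Proof.
exists (2^-1); first by lra.
by rewrite fmorphV rmorph_nat /=; field.
Qed.

Lemma onbdry_insq p d z : onbdry p d z -> insq p d z.
Proof.
case=> [] [t t01 ->].
- by exists t, 0; split=> //; [lra|rewrite mulr0 addr0].
- by exists 1, t; split=> //; [lra|rewrite /=; ring].
- by exists t, 1; split=> //; [lra|rewrite /=; ring].
- by exists 0, t; split=> //; [lra|rewrite /=; ring].
Qed.

Lemma eq_segsum g h n p d : (forall z, onseg p d z -> g z = h z) ->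
  segsum g n p d = segsum h n p d.
Proof.
elim: n p d => [|n IH] p d gh /=; first by rewrite gh //; exact: onseg_mid.
by congr (_ + _); apply: IH => z zd; apply: gh; [exact: onseg_half|exact: onseg_half2].
Qed.

Lemma eq_sqsum g h n p d : (forall z, onbdry p d z -> g z = h z) ->
  sqsum g n p d = sqsum h n p d.
Proof.
move=> gh; rewrite /sqsum.
by congr (_ + _ - _ - _); apply: eq_segsum => z zd; apply: gh;
  [apply: Or41|apply: Or42|apply: Or43|apply: Or44].
Qed.

Lemma segsumP (a : R[i]) g h n p d :
  segsum (fun z => a *: g z + h z) n p d = a *: segsum g n p d + segsum h n p d.
Proof.
elim: n p d => [|n IH] p d /=; first by rewrite scalerDr !scalerA (mulrC d).
by rewrite !IH scalerDr addrACA.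
Qed.

Lemma sqsumP (a : R[i]) g h n p d :
  sqsum (fun z => a *: g z + h z) n p d = a *: sqsum g n p d + sqsum h n p d.
Proof.
rewrite /sqsum !segsumP !opprD !scalerDr !scalerN.
by rewrite (AC (2*2*2*2) ((1*3*5*7)*(2*4*6*8))%AC).
Qed.

Lemma sqsum0 n p d : sqsum (fun=> 0) n p d = 0.
Proof.
have seg0 q e : segsum (fun=> 0) n q e = 0.
  by elim: n q e => [|n IH] q e /=; rewrite ?scaler0// !IH addr0.
by rewrite /sqsum !seg0 !subr0 addr0.
Qed.

Lemma sqsum_scale (a : R[i]) g n p d :
  sqsum (fun z => a *: g z) n p d = a *: sqsum g n p d.
Proof.
rewrite -[RHS]addr0 -(sqsum0 n p d) -sqsumP.
by apply: eq_sqsum => z _; rewrite addr0.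
Qed.

Lemma sqsumD g h n p d :
  sqsum (fun z => g z + h z) n p d = sqsum g n p d + sqsum h n p d.
Proof.
rewrite -[in RHS](scale1r (sqsum g _ _ _)) -sqsumP.
by apply: eq_sqsum => z _; rewrite scale1r.
Qed.

Lemma sqsum_sum (J : Type) (r : seq J) (g : J -> R[i] -> B) n p d :
  sqsum (fun z => \sum_(k <- r) g k z) n p d = \sum_(k <- r) sqsum (g k) n p d.
Proof.
elim: r => [|k r IH].
  rewrite big_nil -[RHS](sqsum0 n p d).
  by apply: eq_sqsum => z _; rewrite big_nil.
rewrite big_cons -IH -sqsumD.
by apply: eq_sqsum => z _; rewrite big_cons.
Qed.

(** The midpoint rule is exact on affine functions, whatever the number of parts. *)
Lemma segsum_affine (a b : B) n p d :
  segsum (fun z => z *: a + b) n p d = (d * (p + d / 2)) *: a + d *: b.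
Proof.
elim: n p d => [|n IH] p d /=; first by rewrite scalerDr scalerA.
rewrite !IH addrACA -(scalerDl a) -(scalerDl b); congr (_ *: a + _ *: b); by field.
Qed.

(** By exactness on each side, the sums vanish before any limit is taken. Goursat's theorem thus
    needs no prior knowledge of integrals of polynomials. *)
Lemma sqsum_affine (a b : B) n p d : sqsum (fun z => z *: a + b) n p d = 0.
Proof.
rewrite /sqsum !segsum_affine !opprD -!(scaleNr _ a) -!(scaleNr _ b).
rewrite (AC (2*2*2*2) ((1*3*5*7)*(2*4*6*8))%AC) /= -!(scalerDl a) -!(scalerDl b).
have -> : d + I * d - d - I * d = 0 by ring.
set s := _ + _ + _ + _; suff -> : s = 0 by rewrite !scale0r addr0.
by rewrite /s; field.
Qed.

Lemma segsum_le g n p d (M : R) :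
  (forall z, onseg p d z -> rnorm (g z) <= M) ->
  rnorm (segsum g n p d) <= cabs d * M.
Proof.
elim: n p d => [|n IH] p d gM /=.
  by rewrite rnorm_scale ler_wpM2l ?cabs_ge0// gM //; exact: onseg_mid.
have -> : cabs d * M = cabs (d / 2) * M + cabs (d / 2) * M.
  by rewrite cabsM cabsV cabs_nat; field.
apply: le_trans (ler_rnormD _ _) (lerD _ _); apply: IH => z zd; apply: gM.
  exact: onseg_half.
exact: onseg_half2.
Qed.

Lemma sqsum_le g n p d (M : R) :
  (forall z, onbdry p d z -> rnorm (g z) <= M) ->
  rnorm (sqsum g n p d) <= 4 * cabs d * M.
Proof.
move=> gM.
have -> : 4 * cabs d * M = cabs d * M + cabs (I * d) * M + cabs d * M + cabs (I * d) * M.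
  by rewrite cabsM cabsi; ring.
apply: le_trans (ler_rnormB _ _) (lerD _ _); last first.
  by apply: segsum_le => z zd; apply: gM; apply: Or44.
apply: le_trans (ler_rnormB _ _) (lerD _ _); last first.
  by apply: segsum_le => z zd; apply: gM; apply: Or43.
apply: le_trans (ler_rnormD _ _) (lerD _ _).
  by apply: segsum_le => z zd; apply: gM; apply: Or41.
by apply: segsum_le => z zd; apply: gM; apply: Or42.
Qed.

(** Each outer side at level [n.+1] is by definition the sum of its halves at level [n], and the
    inner segments are run through twice in opposite directions. *)
Lemma sqsum_quarter g n p d (h := d / 2) :
  sqsum g n.+1 p d = sqsum g n p h + sqsum g n (p + h) h +
    sqsum g n (p + I * h) h + sqsum g n (p + h + I * h) h.
Proof.
rewrite /sqsum /= -/h.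
have -> : I * d / 2 = I * h by rewrite /h; field.
have -> : p + d = p + h + h by rewrite /h; field.
have -> : p + I * d = p + I * h + I * h by rewrite /h; field.
rewrite !(addrAC _ (I * h) h).
exact: quarter_rearrange.
Qed.

End ContourSums.

Lemma scaled_half_small (R : realType) (D e : R) : 0 <= D -> 0 < e ->
  exists N, forall n, (N <= n)%N -> D * 2^-1 ^+ n < e.
Proof.
(* Dividing by [D + 1] covers the case [D = 0]. *)
move=> D0 e0; have d0 : 0 < e / (D + 1) by rewrite divr_gt0 // ltr_wpDl.
have h1 : `|2^-1| < 1 :> R by rewrite ger0_norm //; lra.
have /cvgrPdist_lt/(_ _ d0)[N _ NP] := cvg_expr h1.
exists N => n /NP /=; rewrite sub0r normrN ger0_norm ?exprn_ge0// => h.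
have D1 : 0 < D + 1 by lra.
rewrite ltr_pdivlMr // in h; apply: le_lt_trans h.
by rewrite mulrC ler_wpM2l ?exprn_ge0//; lra.
Qed.

(** * Convergence of the midpoint sums of continuous functions *)

Section SegmentLimit.
Variables (R : realType) (B : completeNormedModType R[i]).
Implicit Types (g : R[i] -> B) (p d z : R[i]).
Local Notation I := ('i%C : R[i]).

Lemma segsum_cst (v : B) n p d : segsum (fun=> v) n p d = d *: v.
Proof.
elim: n p d => [//|n IH] p d /=; rewrite !IH -(scalerDl v).
by congr (_ *: v); field.
Qed.

Lemma segsum_near g n p d (v : B) (e : R) :
  (forall z, onseg p d z -> rnorm (g z - v) <= e) ->
  rnorm (segsum g n p d - d *: v) <= cabs d * e.
Proof.
move=> gv; have -> : segsum g n p d - d *: v = segsum (fun z => g z - v) n p d.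
  transitivity (segsum (fun z => 1 *: g z + (- v)) n p d).
    by rewrite segsumP scale1r segsum_cst scalerN.
  by apply: eq_segsum => z _; rewrite scale1r.
exact: segsum_le.
Qed.

(** Bisection replaces uniform continuity: near a point, all midpoint sums are close to the one of a
    constant, and a Cauchy estimate proportional to the length survives gluing. *)
Lemma segsum_cvgn g p d :
  (forall z, onseg p d z -> {for z, continuous (g : R[i]^o -> B)}) ->
  cvgn (fun n => segsum g n p d).
Proof.
move=> gc; apply: rnorm_cauchy => e e0.
have d1 : 0 < cabs d + 1 by rewrite ltr_wpDl ?cabs_ge0.
pose e' := e / (2 * (cabs d + 1)).
have e'0 : 0 < e' by rewrite divr_gt0 // mulr_gt0.
(* The coordinate [y] is a dummy, so that the bisection of squares serves for segments; gluing then
   uses two quarters only. *)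
pose P n (x y : R) := exists N, forall m k, (N <= m)%N -> (N <= k)%N ->
  rnorm (segsum g m (p + x%:C%C * d) (2^-1 ^+ n * d) -
         segsum g k (p + x%:C%C * d) (2^-1 ^+ n * d)) <=
    cabs (2^-1 ^+ n * d) * (2 * e').
suff : P 0%N 0 0.
  rewrite /P => -[N NP]; exists N => m k Nm Nk.
  have := NP _ _ Nm Nk; rewrite expr0 !mul1r mul0r addr0 => /le_trans; apply.
  have -> : cabs d * (2 * e') = e * (cabs d / (cabs d + 1)).
    by rewrite /e'; field; rewrite gt_eqF.
  by rewrite ler_piMr ?ltW // ltr_pdivrMr // mul1r ltrDl.
apply: dyadic_cousin => [n x y h [N1 P1] [N2 P2] _ _|x0 y0 x01 _].
  exists (maxn N1 N2).+1 => -[//|m] [//|k]; rewrite !ltnS !geq_max /=.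
  move=> /andP[m1 m2] /andP[k1 k2].
  have dE : 2^-1 ^+ n * d / 2 = 2^-1 ^+ n.+1 * d by rewrite exprS; field.
  have pE : p + x%:C%C * d + 2^-1 ^+ n.+1 * d = p + (x + h)%:C%C * d.
    by rewrite rmorphD rmorphXn /= fmorphV rmorph_nat /=; ring.
  rewrite dE pE opprD addrACA; apply: le_trans (ler_rnormD _ _) _.
  apply: le_trans (lerD (P1 _ _ m1 k1) (P2 _ _ m2 k2)) _.
  by rewrite -dE !cabsM cabsV cabs_nat; lra.
have z0 : onseg p d (p + x0%:C%C * d) by exists x0.
have [r r0 rP] := (continuous_rnorm _ _).1 (gc _ z0) _ e'0.
have [N NP] := scaled_half_small (cabs_ge0 d) r0.
exists N => n x y Nn xx0 _.
have near0 z : onseg (p + x%:C%C * d) (2^-1 ^+ n * d) z ->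
    rnorm (g z - g (p + x0%:C%C * d)) <= e'.
  move=> [t t01 ->]; apply/ltW/rP; apply: le_lt_trans (NP _ Nn).
  have -> : p + x%:C%C * d + t%:C%C * (2^-1 ^+ n * d) - (p + x0%:C%C * d) =
      d * (x + t * 2^-1 ^+ n - x0)%:C%C.
    by rewrite rmorphB rmorphD rmorphM rmorphXn /= fmorphV rmorph_nat /=; ring.
  rewrite cabsM ler_wpM2l ?cabs_ge0// /cabs normc_def /= expr0n addr0 sqrtr_sqr.
  rewrite ler_norml.
  have : 0 <= t * 2^-1 ^+ n <= 2^-1 ^+ n.
    by case/andP: t01 => t0 t1; rewrite mulr_ge0 ?exprn_ge0//= ler_piMl ?exprn_ge0.
  by lra.
exists 0%N => m k _ _; rewrite -(subrKA ((2^-1 ^+ n * d) *: g (p + x0%:C%C * d))).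
rewrite mulrDl mul1r mulrDr; apply: le_trans (ler_rnormD _ _) (lerD _ _).
  exact: segsum_near.
by rewrite rnormB; exact: segsum_near.
Qed.

Lemma sqsum_cvgn g p d :
  (forall z, onbdry p d z -> {for z, continuous (g : R[i]^o -> B)}) ->
  cvgn (fun n => sqsum g n p d).
Proof.
move=> gc; apply: is_cvgB; last by apply: segsum_cvgn => z zd; apply: gc; apply: Or44.
apply: is_cvgB; last by apply: segsum_cvgn => z zd; apply: gc; apply: Or43.
apply: is_cvgD; first by apply: segsum_cvgn => z zd; apply: gc; apply: Or41.
by apply: segsum_cvgn => z zd; apply: gc; apply: Or42.
Qed.

End SegmentLimit.

(** * Goursat's theorem *)

Section Goursat.
Variables (R : realType) (B : completeNormedModType R[i]).
Implicit Types (g : R[i] -> B) (p d z : R[i]) (x y : R).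
Local Notation I := ('i%C : R[i]).

(** The affine part contributes nothing, so only the error counts, over a perimeter of length
    [4 * cabs d]. *)
Lemma sqsum_near_affine g n p d (a D : B) z0 (e : R) :
  (forall z, onbdry p d z -> rnorm (g z - a - (z - z0) *: D) <= e) ->
  rnorm (sqsum g n p d) <= 4 * cabs d * e.
Proof.
move=> ge; have -> : sqsum g n p d =
    sqsum (fun z => g z - a - (z - z0) *: D) n p d.
  rewrite -[LHS]addr0 -(sqsum_affine (- D) (z0 *: D - a) n p d) -sqsumD.
  apply: eq_sqsum => z _; rewrite scalerBl scalerN opprB -[RHS]addrA; congr (_ + _).
  by rewrite (AC (1*2) (3*(2*1))%AC).
exact: sqsum_le.
Qed.

Definition sqpt p d x y := p + (x%:C%C + I * y%:C%C) * d.

Lemma sqpt_dist p d n x y x0 y0 z : x <= x0 <= x + 2^-1 ^+ n ->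
  y <= y0 <= y + 2^-1 ^+ n -> insq (sqpt p d x y) (2^-1 ^+ n * d) z ->
  cabs (z - sqpt p d x0 y0) <= 2 * cabs d * 2^-1 ^+ n.
Proof.
move=> xx yy [s [t [s01 t01 ->]]].
have -> : sqpt p d x y + (s%:C%C + I * t%:C%C) * (2^-1 ^+ n * d) - sqpt p d x0 y0
   = d * ((x + s * 2^-1 ^+ n - x0)%:C%C + I * (y + t * 2^-1 ^+ n - y0)%:C%C).
  rewrite !rmorphB !rmorphD !rmorphM rmorphXn /= fmorphV rmorph_nat /sqpt.
  by ring.
rewrite cabsM [2 * _]mulrC -mulrA ler_wpM2l ?cabs_ge0//.
apply: le_trans (ler_cabsD _ _) _; rewrite cabsM cabsi mul1r.
have realabs (u : R) : cabs u%:C%C = `|u|.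
  by rewrite /cabs normc_def /= expr0n addr0 sqrtr_sqr.
rewrite !realabs mulrDl mul1r.
have small (u : R) : 0 <= u <= 1 -> 0 <= u * 2^-1 ^+ n <= 2^-1 ^+ n.
  by case/andP => u0 u1; rewrite mulr_ge0 ?exprn_ge0//= ler_piMl ?exprn_ge0.
move: (small _ s01) (small _ t01) => ss tt.
by apply: lerD; rewrite ler_norml; lra.
Qed.

(** The odd extension of the square root, since [Num.sqrt] is [0] on negative numbers. *)
Definition ssqrt (t : R) : R := Num.sqrt t - Num.sqrt (- t).

Lemma ssqrt_le a b : a <= b -> ssqrt a <= ssqrt b.
Proof. by move=> ab; rewrite /ssqrt lerB // ler_wsqrtr // lerN2. Qed.

(** This is the subadditivity of the square root, applied to [b] and [- a]. *)
Lemma ssqrt_incr a b : a <= 0 <= b -> Num.sqrt (b - a) <= ssqrt b - ssqrt a.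
Proof.
move=> /andP[a0 b0]; rewrite /ssqrt (@ler0_sqrtr _ a)// (@ler0_sqrtr _ (- b)) ?oppr_le0//.
rewrite subr0 sub0r opprK.
rewrite -[leRHS]ger0_norm ?addr_ge0 ?sqrtr_ge0// -sqrtr_sqr ler_wsqrtr //.
rewrite sqrrD !sqr_sqrtr ?oppr_ge0// addrAC lerDl.
by rewrite mulrn_wge0 // mulr_ge0 ?sqrtr_ge0.
Qed.

(* An additive function of squares that is at least the side length on
   the squares containing [(wx, wy)]: it absorbs the exceptional point of
   [sqsum_cvg0]. *)
Definition sqgauge (wx wy x y h : R) : R :=
  (ssqrt (x + h - wx) - ssqrt (x - wx)) * (ssqrt (y + h - wy) - ssqrt (y - wy)).

Lemma sqgauge_ge0 wx wy x y h : 0 <= h -> 0 <= sqgauge wx wy x y h.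
Proof. by move=> h0; rewrite mulr_ge0 // subr_ge0 ssqrt_le // lerD2r lerDl. Qed.

(** By [ssqrt_incr], each of the two factors is at least the square root of [h]. *)
Lemma sqgauge_ge wx wy x y h : x <= wx <= x + h -> y <= wy <= y + h ->
  h <= sqgauge wx wy x y h.
Proof.
move=> xw yw; have h0 : 0 <= h by lra.
rewrite -[leLHS](sqr_sqrtr h0) expr2 /sqgauge.
have E t u : Num.sqrt h = Num.sqrt (t + h - u - (t - u)) by congr Num.sqrt; ring.
apply: ler_pM; rewrite ?sqrtr_ge0//.
  by rewrite (E x wx) ssqrt_incr //; lra.
by rewrite (E y wy) ssqrt_incr //; lra.
Qed.

Lemma sqgauge_quarter wx wy x y h :
  sqgauge wx wy x y (h + h) = sqgauge wx wy x y h + sqgauge wx wy (x + h) y h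
    + sqgauge wx wy x (y + h) h + sqgauge wx wy (x + h) (y + h) h.
Proof. by rewrite /sqgauge !addrA; ring. Qed.

(** The sum over a small square is bounded by [e'] times its area plus its gauge, a bound additive
    under quartering. The area pays at points of derivability, where both perimeter and affine error
    are of the order of the side. At [w] mere continuity leaves a bound linear in the side, which
    the gauge pays. *)
Theorem sqsum_cvg0 g p d w : d != 0 ->
  (forall z, insq p d z -> z != w -> derivable (g : R[i]^o -> B) z 1) ->
  (insq p d w -> {for w, continuous (g : R[i]^o -> B)}) ->
  (fun n => sqsum g n p d) @ \oo --> 0.
Proof.
move=> d0 gd gw; apply/cvg_rnorm => e e0.
(* The coordinates of [w] relative to the square; they may lie outside the unit interval. *)
set wx := complex.Re ((w - p) / d); set wy := complex.Im ((w - p) / d).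
have wE : w = sqpt p d wx wy.
  by rewrite /sqpt /wx /wy -complexE mulfVK // addrC subrK.
set nu := sqgauge wx wy.
have nu0 : 0 < 1 + nu 0 0 1 + 1.
  by rewrite ltr_wpDl // addr_ge0 // sqgauge_ge0.
(* Area plus gauge of the whole square is [1 + nu 0 0 1]; the extra [1] makes the final inequality
   strict. *)
pose e' := e / (1 + nu 0 0 1 + 1).
have e'0 : 0 < e' by rewrite divr_gt0.
pose P n x y := exists N, forall m, (N <= m)%N ->
  rnorm (sqsum g m (sqpt p d x y) (2^-1 ^+ n * d)) <=
  e' * ((2^-1 ^+ n) ^+ 2 + nu x y (2^-1 ^+ n)).
suff : P 0%N 0 0.
  move=> [N NP]; exists N => // m /= /NP.
  rewrite /sqpt expr0 expr1n mul1r mulr0 addr0 mul0r addr0 subr0 => /le_lt_trans; apply.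
  by rewrite /e' mulrAC -mulrA gtr_pMr // ltr_pdivrMr // mul1r ltrDl.
apply: dyadic_cousin => [n x y h [N1 P1] [N2 P2] [N3 P3] [N4 P4]|x0 y0 x01 y01].
  exists (maxn (maxn N1 N2) (maxn N3 N4)).+1 => -[//|m].
  rewrite ltnS !geq_max => /andP[/andP[m1 m2] /andP[m3 m4]].
  rewrite sqsum_quarter.
  have -> : 2^-1 ^+ n * d / 2 = 2^-1 ^+ n.+1 * d by rewrite exprS; field.
  have hE : 2^-1 ^+ n.+1 = h%:C%C by rewrite rmorphXn /= fmorphV rmorph_nat.
  have -> : sqpt p d x y + 2^-1 ^+ n.+1 * d = sqpt p d (x + h) y.
    by rewrite hE /sqpt rmorphD /=; ring.
  have -> : sqpt p d x y + I * (2^-1 ^+ n.+1 * d) = sqpt p d x (y + h).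
    by rewrite hE /sqpt rmorphD /=; ring.
  have -> : sqpt p d (x + h) y + I * (2^-1 ^+ n.+1 * d) = sqpt p d (x + h) (y + h).
    by rewrite hE /sqpt !rmorphD /=; ring.
  rewrite (exprVn_double R n) -/h /nu sqgauge_quarter.
  apply: le_trans (ler_rnormD _ _) _.
  apply: le_trans (lerD (le_trans (ler_rnormD _ _) (lerD (ler_rnormD _ _) (lexx _))) (lexx _)) _.
  apply: le_trans (lerD (lerD (lerD (P1 _ m1) (P2 _ m2)) (P3 _ m3)) (P4 _ m4)) _.
  by rewrite -/h le_eqVlt; apply/orP; left; apply/eqP; rewrite /nu; ring.
set z0 := sqpt p d x0 y0.
have z0in : insq p d z0 by exists x0, y0.
have dpos : 0 < cabs d by rewrite cabs_gt0.
have dist n x y z : x <= x0 <= x + 2^-1 ^+ n -> y <= y0 <= y + 2^-1 ^+ n ->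
    onbdry (sqpt p d x y) (2^-1 ^+ n * d) z -> cabs (z - z0) <= 2 * cabs d * 2^-1 ^+ n.
  by move=> xx yy /onbdry_insq; exact: sqpt_dist.
have cabsd n : cabs (2^-1 ^+ n * d) = cabs d * 2^-1 ^+ n.
  by rewrite cabsM cabsX cabsV cabs_nat mulrC.
have D0 : 0 <= 2 * cabs d by rewrite mulr_ge0 ?cabs_ge0.
have [z0w|z0w] := eqVneq z0 w.
  have e1 : 0 < e' / (4 * cabs d) by rewrite divr_gt0 // mulr_gt0.
  have gcont : {for z0, continuous (g : R[i]^o -> B)} by rewrite z0w; apply: gw; rewrite -z0w.
  have [r r0 rP] := (continuous_rnorm _ _).1 gcont _ e1.
  have [N NP] := scaled_half_small D0 r0.
  exists N => n x y Nn xx yy; exists 0%N => m _.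
  apply: (le_trans (sqsum_near_affine (a := g z0) (D := 0) (z0 := z0) (e := e' / (4 * cabs d)) _ _)).
    move=> z /(dist _ _ _ _ xx yy) zd; rewrite scaler0 subr0; apply/ltW/rP.
    exact: le_lt_trans zd (NP _ Nn).
  have -> : 4 * cabs (2^-1 ^+ n * d) * (e' / (4 * cabs d)) = e' * 2^-1 ^+ n.
    by rewrite cabsd; field; rewrite gt_eqF.
  have [wx0 wy0] : wx = x0 /\ wy = y0.
    have : wx%:C%C + I * wy%:C%C = x0%:C%C + I * y0%:C%C.
      by apply: (mulIf d0); apply: (addrI p); rewrite -/(sqpt p d wx wy) -wE -z0w.
    by case; rewrite !(mul0r, mulr0, mul1r, subr0, sub0r, oppr0, addr0, add0r) => -> ->.
  rewrite ler_pM2l // ler_wpDl ?exprn_ge0 //.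
  by apply: sqgauge_ge; rewrite ?wx0 ?wy0.
have [D DP] := derivable_rnorm (gd _ z0in z0w).
(* The factor [8] is [4] from the perimeter times [2] from [sqpt_dist]; each of the two also brings
   one [cabs d]. *)
have e1 : 0 < e' / (8 * cabs d ^+ 2) by rewrite divr_gt0 // mulr_gt0 // exprn_gt0.
have [r r0 rP] := DP _ e1.
have [N NP] := scaled_half_small D0 r0.
exists N => n x y Nn xx yy; exists 0%N => m _.
apply: (le_trans (sqsum_near_affine (a := g z0) (D := D) (z0 := z0)
   (e := e' / (8 * cabs d ^+ 2) * (2 * cabs d * 2^-1 ^+ n)) _ _)).
  move=> z /(dist _ _ _ _ xx yy) zd; apply: le_trans (rP _ _) _.
    exact: le_lt_trans zd (NP _ Nn).
  by rewrite ler_wpM2l // ltW.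
have -> : 4 * cabs (2^-1 ^+ n * d) * (e' / (8 * cabs d ^+ 2) * (2 * cabs d * 2^-1 ^+ n)) = e' * (2^-1 ^+ n) ^+ 2.
  by rewrite cabsd; field; rewrite gt_eqF.
by rewrite ler_pM2l // lerDl sqgauge_ge0 // exprn_ge0.
Qed.

End Goursat.

(** * Square contours around the origin and their doubling *)

Section Contour.
Variables (R : realType) (B : completeNormedModType R[i]).
Implicit Types (g : R[i] -> B) (p d z r : R[i]) (a b : R).
Local Notation I := ('i%C : R[i]).

(* The contour is the boundary of the square of half side [r] centred at [0]. *)
Definition contour_sum g r n : B := sqsum g n (- (1 + I) * r) (2 * r).

(** Quartering twice cuts the large square into sixteen of side [r]. The four with corner
    coordinates in [-1], [0] make up the small contour, itself quartered once; this explains the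
    levels [n.+2] and [n.+1]. *)
Lemma contour_sum_double g r n (Q := fun a b => sqsum g n ((a%:C%C + I * b%:C%C) * r) r) :
  contour_sum g (2 * r) n.+2 = contour_sum g r n.+1 +
   ((((Q (-2) (-2) + Q (-1) (-2)) + (Q (-2) (-1) + Q 0 (-2))) +
     ((Q 1 (-2) + Q 1 (-1)) + (Q (-2) 0 + Q (-2) 1))) +
    ((Q (-1) 1 + Q 1 0) + (Q 0 1 + Q 1 1))).
Proof.
have quarter m (s : R[i]) a b : sqsum g m.+1 ((a%:C%C + I * b%:C%C) * s) (2 * s) =
    sqsum g m ((a%:C%C + I * b%:C%C) * s) s +
    sqsum g m (((a + 1)%:C%C + I * b%:C%C) * s) s +
    sqsum g m ((a%:C%C + I * (b + 1)%:C%C) * s) s +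
    sqsum g m (((a + 1)%:C%C + I * (b + 1)%:C%C) * s) s.
  rewrite sqsum_quarter; have -> : 2 * s / 2 = s by field.
  by rewrite !rmorphD /=; congr (_ + sqsum _ _ _ _ + sqsum _ _ _ _ + sqsum _ _ _ _); ring.
have quarter2 m (s : R[i]) a b : sqsum g m.+1 ((a%:C%C + I * b%:C%C) * (2 * s)) (2 * s) =
    sqsum g m ((((a + a)%:C%C + I * (b + b)%:C%C) * s)) s +
    sqsum g m (((a + a + 1)%:C%C + I * (b + b)%:C%C) * s) s +
    sqsum g m (((a + a)%:C%C + I * (b + b + 1)%:C%C) * s) s +
    sqsum g m (((a + a + 1)%:C%C + I * (b + b + 1)%:C%C) * s) s.
  rewrite -quarter; congr sqsum.
  by rewrite !rmorphD /=; ring.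
have start s : - (1 + I) * s = ((-1)%:C%C + I * (-1)%:C%C) * s.
  by rewrite rmorphN rmorph1 /=; ring.
rewrite /contour_sum !start !quarter !quarter2.
have -> : -1 + 1 = 0 :> R by ring.
have -> : -1 + -1 + 1 = -1 :> R by ring.
have -> : -1 + -1 = -2 :> R by ring.
have -> : 0 + 0 = 0 :> R by ring.
have -> : 0 + 1 = 1 :> R by ring.
rewrite -!/(Q _ _).
rewrite [LHS](AC (4*4*4*4) (((4*7)*10*13)*
  ((((1*2)*(3*5))*((6*8)*(9*11)))*((12*14)*(15*16))))%AC).
by rewrite /=.
Qed.

(** The twelve outer squares do not contain [0], so their sums tend to [0] by [sqsum_cvg0], whose
    condition at [w = 0] is then vacuous. *)
Lemma contour_sum_double_cvg g r (l : B) : r != 0 ->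
  (forall z, z != 0 -> derivable (g : R[i]^o -> B) z 1) ->
  contour_sum g r @ \oo --> l -> contour_sum g (2 * r) @ \oo --> l.
Proof.
move=> r0 gd gl; rewrite -cvg_shiftS -cvg_shiftS /=.
have -> : (fun n => contour_sum g (2 * r) n.+2) = _ :=
  funext (contour_sum_double g r).
have away a b : [|| a == -2, a == 1, b == -2 | b == 1] ->
    (fun n => sqsum g n ((a%:C%C + I * b%:C%C) * r) r) @ \oo --> 0.
  move=> ab; have nin : ~ insq ((a%:C%C + I * b%:C%C) * r) r 0.
    move=> [x [y [x01 y01]]]; rewrite -mulrDl => /esym/eqP.
    rewrite mulf_eq0 (negPf r0) orbF => /eqP; case.
    rewrite !(mul0r, mulr0, mul1r, subr0, sub0r, oppr0, addr0, add0r).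
    by case/or4P : ab => /eqP ->; lra.
  apply: (sqsum_cvg0 (w := 0)) => // z zin z0; exact: gd.
have cvg0D (u v : nat -> B) : u @ \oo --> 0 -> v @ \oo --> 0 ->
    (fun n => u n + v n) @ \oo --> 0.
  by move=> u0 v0; rewrite -[0]addr0; exact: cvgD.
rewrite -[l]addr0; apply: cvgD; first by rewrite (cvg_shiftS (contour_sum g r)).
apply: (cvg0D); first apply: (cvg0D).
all: apply: (cvg0D); apply: (cvg0D); apply: away; by rewrite eqxx ?orbT.
Qed.

Lemma contour_sum_exp2_cvg g (l : B) j :
  (forall z, z != 0 -> derivable (g : R[i]^o -> B) z 1) ->
  contour_sum g 1 @ \oo --> l -> contour_sum g (2 ^+ j) @ \oo --> l.
Proof.
move=> gd gl; elim: j => [//|j IH]; rewrite exprS.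
by apply: contour_sum_double_cvg => //; rewrite expf_neq0.
Qed.

Lemma contourP r z : onbdry (- (1 + I) * r) (2 * r) z ->
  exists a b, [/\ z = (a%:C%C + I * b%:C%C) * r, -1 <= a <= 1, -1 <= b <= 1 &
    [|| a == 1, a == -1, b == 1 | b == -1]].
Proof.
case=> [] [t t01 ->].
- exists (2 * t - 1), (-1); rewrite eqxx !orbT; split=> //; [|lra|lra].
  by rewrite rmorphB rmorphN rmorphM rmorph_nat rmorph1 /=; ring.
- exists 1, (2 * t - 1); rewrite eqxx ?orbT; split=> //; [|lra|lra].
  by rewrite rmorphB rmorphM rmorph_nat rmorph1 /=; ring.
- exists (2 * t - 1), 1; rewrite eqxx !orbT; split=> //; [|lra|lra].
  by rewrite rmorphB rmorphM rmorph_nat rmorph1 /=; ring.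
- exists (-1), (2 * t - 1); rewrite eqxx !orbT; split=> //; [|lra|lra].
  by rewrite rmorphB rmorphN rmorphM rmorph_nat rmorph1 /=; ring.
Qed.

(** After division by [r], the larger coordinate has absolute value [1] and the sum of both absolute
    values is at most [2]. *)
Lemma contour_cabs r z : onbdry (- (1 + I) * r) (2 * r) z ->
  cabs r <= cabs z <= 2 * cabs r.
Proof.
move=> /contourP[a [b [-> a1 b1 ab]]]; rewrite cabsM.
set u := _ + _; have Re_u : complex.Re u = a by rewrite /u /=; ring.
have Im_u : complex.Im u = b by rewrite /u /=; ring.
have := ler_Re u; have := ler_Im u; have := ler_cabs_ReIm u.
rewrite Re_u Im_u => uab ub ua.
rewrite -{1}[cabs r]mul1r !ler_wpM2r ?cabs_ge0//.
  by move: a1 b1; rewrite -!ler_norml => a1 b1; lra.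
by case/or4P: ab ua ub => /eqP ->; rewrite ?normrN normr1.
Qed.

Lemma contour_neq0 r z : r != 0 -> onbdry (- (1 + I) * r) (2 * r) z -> z != 0.
Proof.
by move=> r0 /contour_cabs/andP[rz _]; rewrite -cabs_gt0 (lt_le_trans _ rz) // cabs_gt0.
Qed.

Lemma contour_sum_le g r n (M : R) :
  (forall z, cabs r <= cabs z <= 2 * cabs r -> rnorm (g z) <= M) ->
  rnorm (contour_sum g r n) <= 8 * cabs r * M.
Proof.
move=> gM; have -> : 8 * cabs r * M = 4 * cabs (2 * r) * M.
  by rewrite cabsM cabs_nat; ring.
by apply: sqsum_le => z /contour_cabs; exact: gM.
Qed.

Lemma contour_sum_cvgn g r : r != 0 ->
  (forall z, z != 0 -> {for z, continuous (g : R[i]^o -> B)}) ->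
  cvgn (contour_sum g r).
Proof.
by move=> r0 gc; apply: sqsum_cvgn => z zb; apply: gc; exact: contour_neq0 zb.
Qed.

End Contour.

(** * A lower bound for the integral of the inverse function *)

Section Period.
Variable R : realType.
Local Notation I := ('i%C : R[i]).
Local Notation C := (complex_banach R).
Implicit Types (g : R[i] -> C) (p d z : R[i]) (eta u : R).

(** A midpoint sum is an average of values of [d * g z], so it inherits their bounds. *)
Lemma segsum_Im_ge g n p d eta :
  (forall z, onseg p d z -> eta <= complex.Im (d * g z)) ->
  eta <= complex.Im (segsum g n p d).
Proof.
elim: n p d eta => [|n IH] p d eta gd /=; first exact/gd/onseg_mid.
have half z : eta <= complex.Im (d * g z) -> eta / 2 <= complex.Im (d / 2 * g z).
  move=> h; have -> : d / 2 * g z = (2^-1)%:C%C * (d * g z).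
    by rewrite fmorphV rmorph_nat /=; field.
  by case: (d * g z) h => a b /=; lra.
have ImD (a b : R[i]) : complex.Im (a + b) = complex.Im a + complex.Im b.
  by case: a; case: b.
rewrite ImD [leLHS]splitr; apply: lerD; apply: IH => z zd; apply/half/gd.
  exact: onseg_half.
exact: onseg_half2.
Qed.

Lemma segsum_Im_le g n p d eta :
  (forall z, onseg p d z -> complex.Im (d * g z) <= eta) ->
  complex.Im (segsum g n p d) <= eta.
Proof.
elim: n p d eta => [|n IH] p d eta gd /=; first exact/gd/onseg_mid.
have half z : complex.Im (d * g z) <= eta -> complex.Im (d / 2 * g z) <= eta / 2.
  move=> h; have -> : d / 2 * g z = (2^-1)%:C%C * (d * g z).
    by rewrite fmorphV rmorph_nat /=; field.
  by case: (d * g z) h => a b /=; lra.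
have ImD (a b : R[i]) : complex.Im (a + b) = complex.Im a + complex.Im b.
  by case: a; case: b.
rewrite ImD [leRHS]splitr; apply: lerD; apply: IH => z zd; apply/half/gd.
  exact: onseg_half.
exact: onseg_half2.
Qed.

(** On the bottom side of the unit contour this quotient is [d * g z] for the inverse function; its
    imaginary part is [2 / (u ^+ 2 + 1)]. *)
Lemma Im_side u : -1 <= u <= 1 -> 1 <= complex.Im (2 / (u +i* -1)%C).
Proof.
move=> u1; have -> : complex.Im (2 / (u +i* -1)%C) = 2 / (u ^+ 2 + 1).
  have -> : 2 = (2 +i* 0)%C :> R[i] by rewrite complexr0 rmorph_nat.
  by rewrite /= sqrrN expr1n; ring.
have u2 : 0 <= u ^+ 2 <= 1 by rewrite sqr_ge0 expr2 /=; nra.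
by rewrite ler_pdivlMr ?mul1r; lra.
Qed.

(** Multiplying both [z] and [d] by [I] or [-1] leaves [d / z] unchanged, so every side reduces to
    the bottom one and contributes at least [1]. Top and left are subtracted in [sqsum], hence their
    bounds by [-1]. *)
Lemma contour_sum_inv_Im n :
  4 <= complex.Im (contour_sum (fun z : R[i] => z^-1 : C) 1 n).
Proof.
rewrite /contour_sum /sqsum !mulr1.
have ImB (a b : R[i]) : complex.Im (a - b) = complex.Im a - complex.Im b.
  by case: a; case: b.
have ImD (a b : R[i]) : complex.Im (a + b) = complex.Im a + complex.Im b.
  by case: a; case: b.
have I2 : I ^+ 2 = -1 by rewrite sqr_i.
(* For [ring], [I] is a mere variable; supplying a multiple of [I ^+ 2 + 1] turns the identities
   below into polynomial ones. *)
have modI (a x y : R[i]) : x = y + a * (I ^+ 2 + 1) -> x = y.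
  by move=> ->; rewrite I2 addNr mulr0 addr0.
have I0 : I != 0 by rewrite eq_complex /= oner_eq0 andbF.
rewrite !ImB ImD.
have t1 (t : R) : 0 <= t <= 1 -> -1 <= 2 * t - 1 <= 1 by lra.
have t2 (t : R) : 0 <= t <= 1 -> -1 <= 1 - 2 * t <= 1 by lra.
have mk (a b : R) : (a +i* b)%C = a%:C%C + I * b%:C%C.
  by apply/eqP; rewrite eq_complex /=; apply/andP; split; apply/eqP; ring.
have bottom : 1 <= complex.Im (segsum (fun z : R[i] => z^-1 : C) n (- (1 + I)) 2).
  apply: segsum_Im_ge => z [t t01 ->].
  have -> : - (1 + I) + t%:C%C * 2 = ((2 * t - 1) +i* -1)%C.
    by rewrite (mk (2 * t - 1)) rmorphB rmorphM rmorphN rmorph1 rmorph_nat /=; ring.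
  exact/Im_side/t1.
have right : 1 <= complex.Im (segsum (fun z : R[i] => z^-1 : C) n (- (1 + I) + 2) (I * 2)).
  apply: segsum_Im_ge => z [t t01 ->].
  have -> : - (1 + I) + 2 + t%:C%C * (I * 2) = I * ((2 * t - 1) +i* -1)%C.
    apply: (@modI 1); rewrite (mk (2 * t - 1)) rmorphB rmorphM.
    by rewrite rmorphN rmorph1 rmorph_nat /=; ring.
  rewrite invfM mulrACA divff // mul1r.
  exact/Im_side/t1.
have top : complex.Im (segsum (fun z : R[i] => z^-1 : C) n (- (1 + I) + I * 2) 2) <= -1.
  apply: segsum_Im_le => z [t t01 ->].
  have -> : - (1 + I) + I * 2 + t%:C%C * 2 = - ((1 - 2 * t) +i* -1)%C.
    by rewrite (mk (1 - 2 * t)) rmorphB rmorphM rmorphN rmorph1 rmorph_nat /=; ring.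
  rewrite invrN mulrN; have := Im_side (t2 _ t01).
  by case: (2 / _) => a b /=; rewrite lerN2.
have left : complex.Im (segsum (fun z : R[i] => z^-1 : C) n (- (1 + I)) (I * 2)) <= -1.
  apply: segsum_Im_le => z [t t01 ->].
  have -> : - (1 + I) + t%:C%C * (I * 2) = - (I * ((1 - 2 * t) +i* -1)%C).
    apply: (@modI (-1)); rewrite (mk (1 - 2 * t)) rmorphB rmorphM.
    by rewrite rmorphN rmorph1 rmorph_nat /=; ring.
  rewrite invrN mulrN invfM mulrACA divff // mul1r; have := Im_side (t2 _ t01).
  by case: (2 / _) => a b /=; rewrite lerN2.
by lra.
Qed.

End Period.

(** * Contour integrals against negative powers and Cauchy's estimate *)

Section CauchyFormula.
Variables (R : realType) (B : completeNormedModType R[i]).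
Local Notation I := ('i%C : R[i]).
Implicit Types (f g : R[i] -> B) (z w : R[i]) (k n j : nat).

Definition holo f := forall z, derivable (f : R[i]^o -> B) z 1.

Lemma derivable_inv_pow (w : R[i]^o) n (z : R[i]^o) : z != w ->
  derivable (fun y : R[i]^o => (y - w)^-1 ^+ n : R[i]^o) z 1.
Proof.
move=> zw; have dV : derivable (fun y : R[i]^o => (y - w)^-1 : R[i]^o) z 1.
  apply: (@derivableV _ _ (fun y : R[i]^o => y - w : R[i]^o)).
    by rewrite subr_eq0.
  by apply: derivableB; [exact: derivable_id|exact: derivable_cst].
elim: n => [|n IH]; first exact: derivable_cst.
under eq_fun do rewrite exprS.
exact: derivableM dV IH.
Qed.

Definition cauchy_kernel f k z := z^-1 ^+ k *: f z.

Lemma cauchy_kernel_derivable f k z : holo f -> z != 0 ->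
  derivable (cauchy_kernel f k : R[i]^o -> B) z 1.
Proof.
move=> fh z0; apply: derivable_scale; last exact: fh.
have := @derivable_inv_pow 0 k z z0.
by under eq_fun do rewrite subr0.
Qed.

Definition contour_int f k : B := limn (contour_sum (cauchy_kernel f k) 1).

(** The kernel is singular at [0] only, so the limit is the same on all contours of half side
    [2 ^+ j]; letting [j] vary is the source of all decay estimates. *)
Lemma contour_int_cvg f k j : holo f ->
  contour_sum (cauchy_kernel f k) (2 ^+ j) @ \oo --> contour_int f k.
Proof.
move=> fh; apply: contour_sum_exp2_cvg => [z|]; first exact: cauchy_kernel_derivable.
apply: contour_sum_cvgn => [|z z0]; first exact: oner_neq0.
by apply/derivable_continuous/cauchy_kernel_derivable.
Qed.

Lemma cabs_exp2 j : cabs (2 ^+ j : R[i]) = 2 ^+ j.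
Proof. by rewrite cabsX cabs_nat. Qed.

(** Cauchy's estimate: the contour has length [8 * 2 ^+ j], which cancels one of the [k.+1] inverse
    powers, and it lies in the disc of radius [2 ^+ j.+1]. *)
Lemma contour_int_le f k j (M : R) : holo f ->
  (forall z, cabs z <= 2 ^+ j.+1 -> rnorm (f z) <= M) ->
  rnorm (contour_int f k.+1) <= 8 * M * (2 ^+ j)^-1 ^+ k.
Proof.
move=> fh fM; apply: cvgn_rnorm_bound (@contour_int_cvg f k.+1 j fh) _ => n.
have j0 : 0 < 2 ^+ j :> R by rewrite exprn_gt0.
have -> : 8 * M * (2 ^+ j)^-1 ^+ k = 8 * cabs (2 ^+ j : R[i]) * ((2 ^+ j)^-1 ^+ k.+1 * M).
  by rewrite cabs_exp2 exprS; field; rewrite ?gt_eqF // exprn_gt0.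
apply: contour_sum_le => z; rewrite cabs_exp2 -exprS => /andP[jz zj].
rewrite /cauchy_kernel rnorm_scale cabsX cabsV.
apply: ler_pM; rewrite ?exprn_ge0 ?invr_ge0 ?cabs_ge0 ?rnorm_ge0 //; last exact: fM.
apply: lerXn2r; rewrite ?nnegrE ?invr_ge0 ?cabs_ge0 ?(ltW j0)//.
by rewrite lef_pV2 // posrE // (lt_le_trans j0).
Qed.

Lemma contour_intP (a : R[i]) f g k : holo f -> holo g ->
  contour_int (fun z => a *: f z + g z) k = a *: contour_int f k + contour_int g k.
Proof.
move=> fh gh; have := @contour_int_cvg f k 0 fh; have := @contour_int_cvg g k 0 gh.
rewrite expr0 => gl fl; apply: cvg_lim => //.
have -> : contour_sum (cauchy_kernel (fun z => a *: f z + g z) k) 1 =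
  (fun n => a *: contour_sum (cauchy_kernel f k) 1 n + contour_sum (cauchy_kernel g k) 1 n).
  apply/funext => n; rewrite -sqsumP; apply: eq_sqsum => z _.
  by rewrite /cauchy_kernel scalerDr !scalerA mulrC.
by apply: cvgD => //; apply: cvgZl_tmp.
Qed.

(* In fact [2 * pi * 'i]. *)
Definition period : R[i] := limn (contour_sum (fun z : R[i] => z^-1 : complex_banach R) 1).

Lemma inv_contour_cvg :
  contour_sum (fun z : R[i] => z^-1 : complex_banach R) 1 @ \oo --> (period : complex_banach R).
Proof.
apply: contour_sum_cvgn => [|z z0]; first exact: oner_neq0.
apply: derivable_continuous.
have := @derivable_inv_pow 0 1 z z0.
by under eq_fun do rewrite subr0 expr1.
Qed.

(** Were the limit [0], some sum would have modulus below [4], against [contour_sum_inv_Im]. *)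
Lemma period_neq0 : period != 0.
Proof.
apply/eqP => p0; have /cvg_rnorm/(_ 4)[] := inv_contour_cvg; first by [].
move=> N _ /(_ N (leqnn _)); rewrite p0 subr0 /= ltNge => /negP; apply.
apply: le_trans (contour_sum_inv_Im R N) _; apply: le_trans (ler_norm _) _.
exact: ler_Im.
Qed.

Lemma sqsum_scaler (a : R[i] -> complex_banach R) (v : B) n p d :
  sqsum (fun z => (a z : R[i]) *: v) n p d = (sqsum a n p d : R[i]) *: v.
Proof.
have seg q e : segsum (fun z => (a z : R[i]) *: v) n q e = (segsum a n q e : R[i]) *: v.
  by elim: n q e => [|n IH] q e /=; rewrite ?scalerA// !IH -scalerDl.
by rewrite /sqsum !seg -scalerDl -!scalerBl.
Qed.

Lemma holo_cst (v : B) : holo (fun=> v).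
Proof. by move=> z; exact: derivable_cst. Qed.

(** For positive [k] no primitive is used: Cauchy's estimate on ever larger contours forces the
    integral to be [0]. *)
Lemma contour_int_cst (v : B) k : contour_int (fun=> v) k.+1 = (k == 0)%:R *: (period *: v).
Proof.
case: k => [|k]; last first.
  rewrite scale0r; apply: rnorm_small => e e0.
  have v0 : 0 <= 8 * rnorm v by rewrite mulr_ge0 ?rnorm_ge0.
  have [N NP] := scaled_half_small v0 e0.
  apply: le_trans (ltW (NP N (leqnn _))).
  have := @contour_int_le (fun=> v) k.+1 N (rnorm v) (@holo_cst v) (fun _ _ => lexx _).
  move/le_trans; apply.
  rewrite ler_wpM2l // exprS -exprVn; apply: ler_piMr; first by rewrite exprn_ge0.
  by rewrite exprn_ile1 ?exprn_ge0 // exprn_ile1 // invf_le1 // ler1n.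
rewrite scale1r; apply: cvg_lim => //.
have -> : contour_sum (cauchy_kernel (fun=> v) 1) 1 =
   (fun n => (contour_sum (fun z : R[i] => z^-1 : complex_banach R) 1 n : R[i]) *: v).
  by apply/funext => n; rewrite /contour_sum -sqsum_scaler.
by apply: cvgZr_tmp; exact: inv_contour_cvg.
Qed.

End CauchyFormula.

(** * Compact sets and discs in the complex plane *)

Section Compact.
Variables (R : realType) (B : completeNormedModType R[i]).
Local Notation I := ('i%C : R[i]).

Lemma compact_cabs_bounded (K : set R[i]^o) (h : R[i]^o -> R) :
  (forall z, {for z, continuous (h : R[i]^o -> R^o)}) -> compact K ->
  exists M, forall z, K z -> h z <= M.
Proof.
move=> hc cK; have /compact_bounded[M [_ hM]] : compact ((h : R[i]^o -> R^o) @` K).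
  apply: continuous_compact => //; apply: continuous_subspaceT; exact: hc.
exists (M + 1) => z Kz; apply: le_trans (ler_norm _) _.
by apply: (hM (M + 1)); rewrite ?ltrDl //; exists z.
Qed.

Lemma cabs_continuous (z : R[i]^o) : {for z, continuous (@cabs R : R[i]^o -> R^o)}.
Proof.
apply: (cvgrPdist_lt (F := nbhs z) _ _).2 => e e0; apply/nbhs_cabs; exists e => // w wz.
apply: le_lt_trans wz; rewrite ler_norml.
have := ler_cabsD (z - w) w; have := ler_cabsD (w - z) z.
by rewrite !subrK (cabsB z w); lra.
Qed.

Lemma rnorm_continuous (f : R[i]^o -> B) (z : R[i]^o) : {for z, continuous f} ->
  {for z, continuous (fun w => rnorm (f w) : R^o)}.
Proof.
move=> fz; apply: (cvgrPdist_lt (F := nbhs z) _ _).2 => e e0; apply/nbhs_cabs.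
have [d d0 dP] := (continuous_rnorm _ _).1 fz _ e0.
exists d => // w /dP; apply: le_lt_trans; rewrite ler_norml.
have := ler_rnormD (f z - f w) (f w); have := ler_rnormD (f w - f z) (f z).
by rewrite !subrK (rnormB (f z)); lra.
Qed.

(** The disc is closed in the image of a compact real square under the continuous map [toC]. *)
Lemma compact_disc (r : R) : compact [set z : R[i]^o | cabs z <= r].
Proof.
pose toC (u : R^o * R^o) : R[i]^o := (u.1 +i* u.2)%C.
have toCc : continuous toC.
  move=> u; apply/(cvgrPdist_lt) => e; rewrite ltcE => /andP[/eqP Ie Re0].
  have e2 : 0 < complex.Re e / 2 by rewrite divr_gt0.
  have [A B'] : (nbhs u.1 [set x : R^o | `|u.1 - x| < complex.Re e / 2]) /\ 
    (nbhs u.2 [set x : R^o | `|u.2 - x| < complex.Re e / 2]).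
    by split; apply/nbhs_ballP; exists (complex.Re e / 2).
  exists ([set x : R^o | `|u.1 - x| < complex.Re e / 2],
          [set x : R^o | `|u.2 - x| < complex.Re e / 2]); first by [].
  move=> [x y] [/= xu yu].
  rewrite cabsE [e]complexE Ie mulr0 addr0 ltcR.
  apply: le_lt_trans (ler_cabs_ReIm _) _; rewrite [ltRHS]splitr.
  exact: ltrD.
have cI : compact (`[- r, r]%classic : set R^o) by exact: segment_compact.
have cimg : compact (toC @` (`[- r, r] `*` `[- r, r])).
  apply: continuous_compact; last exact: compact_setX.
  exact: continuous_subspaceT.
apply: (subclosed_compact _ cimg).
  have -> : [set z : R[i]^o | cabs z <= r] = (@cabs R : R[i]^o -> R^o) @^-1` [set x | x <= r].
    by [].
  by apply: preimage_closed; [move=> z _; exact: cabs_continuous|exact: closed_le].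
move=> z /= zr; exists (complex.Re z, complex.Im z); last by case: (z).
split; rewrite /= in_itv /= -ler_norml.
  exact: le_trans (ler_Re z) zr.
exact: le_trans (ler_Im z) zr.
Qed.

Lemma continuous_disc_bounded (f : R[i]^o -> B) (r : R) :
  continuous f -> exists M, forall z, cabs z <= r -> rnorm (f z) <= M.
Proof.
move=> fc; apply: compact_cabs_bounded (@compact_disc r) => z.
exact/rnorm_continuous/fc.
Qed.

Lemma compact_disc_sub (K : set R[i]^o) : compact K ->
  exists M, forall z, K z -> cabs z <= M.
Proof. by apply: compact_cabs_bounded => z; exact: cabs_continuous. Qed.

End Compact.

(** * Taylor expansion *)

Section Taylor.
Variables (R : realType) (B : completeNormedModType R[i]).
Local Notation I := ('i%C : R[i]).
Implicit Types (f : R[i] -> B) (z w : R[i]) (k n j : nat).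

Definition taylor f k : B := (period R)^-1 *: contour_int f k.+1.

Lemma taylorP (a : R[i]) f (g : R[i] -> B) k : holo f -> holo g ->
  taylor (fun z => a *: f z + g z) k = a *: taylor f k + taylor g k.
Proof.
move=> fh gh; rewrite /taylor contour_intP // scalerDr !scalerA.
by rewrite [X in X *: _]mulrC.
Qed.

Lemma taylor_le f k j (M : R) : holo f ->
  (forall z, cabs z <= 2 ^+ j.+1 -> rnorm (f z) <= M) ->
  rnorm (taylor f k) <= 8 / cabs (period R) * M * (2 ^+ j)^-1 ^+ k.
Proof.
move=> fh fM; rewrite rnorm_scale cabsV.
have -> : 8 / cabs (period R) * M * (2 ^+ j)^-1 ^+ k =
  (cabs (period R))^-1 * (8 * M * (2 ^+ j)^-1 ^+ k) by ring.
by rewrite ler_wpM2l ?invr_ge0 ?cabs_ge0 // contour_int_le.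
Qed.

(** The finite geometric expansion in [w / z] with its exact remainder, so no series has to be
    interchanged with an integral. *)
Lemma inv_sub_geometric z w n : z != 0 -> z != w ->
  (z - w)^-1 = \sum_(k < n) w ^+ k * z^-1 ^+ k.+1 + (w / z) ^+ n * (z - w)^-1.
Proof.
move=> z0 zw; elim: n => [|n IH]; first by rewrite big_ord0 add0r mul1r.
rewrite big_ord_recr /= -addrA {1}IH; congr (_ + _).
rewrite !exprS !exprMn; set A := w ^+ n; set A' := z^-1 ^+ n.
by field; rewrite z0 subr_eq0 zw.
Qed.

(** [D] is meant to be the derivative of [f] at [w], which makes the quotient continuous there; [w]
    is the exceptional point of [sqsum_cvg0]. *)
Definition diff_quot f (D : B) w z : B :=
  if z == w then D else (z - w)^-1 *: (f z - f w).

Lemma diff_quot_derivable f D w z : holo f -> z != w ->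
  derivable (diff_quot f D w : R[i]^o -> B) z 1.
Proof.
move=> fh zw; pose q (y : R[i]^o) : B := ((y - w)^-1 : R[i]^o) *: (f y - f w).
have dq : derivable q z 1.
  apply: derivable_scale; last by apply: derivableB; [exact: fh|exact: derivable_cst].
  by have := @derivable_inv_pow R w 1 z zw; under eq_fun do rewrite expr1.
apply: (near_eq_derivable _ dq); apply/nbhs_cabs; exists (cabs (z - w)); first by rewrite cabs_gt0 subr_eq0.
move=> y yz; rewrite /diff_quot /q; case: eqP => // yw.
by move: yz; rewrite yw cabsB ltxx.
Qed.

Lemma diff_quot_continuous f w : holo f -> exists D,
  forall z, {for z, continuous (diff_quot f D w : R[i]^o -> B)}.
Proof.
move=> fh; have [D DP] := derivable_rnorm (fh w).
exists D => z; have [->|zw] := eqVneq z w; last exact/derivable_continuous/diff_quot_derivable.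
apply/continuous_rnorm => e e0; have e2 : 0 < e / 2 by rewrite divr_gt0.
have [d d0 dP] := DP _ e2.
exists d => // y /dP; rewrite /diff_quot eqxx; case: eqP => [_ _|/eqP yw].
  by rewrite subrr rnorm0.
have yw0 : 0 < cabs (y - w) by rewrite cabs_gt0 subr_eq0.
rewrite mulrC -ler_pdivrMl // -cabsV -rnorm_scale scalerBr scalerA mulVf ?subr_eq0//.
by rewrite scale1r => /le_lt_trans; apply; rewrite ltr_pdivrMr // ltr_pMr // ltrDl.
Qed.

(** The integral of the difference quotient [G] vanishes. Expanding [(z - w)^-1] splits it into the
    Taylor polynomial of [f - f w] at [w], times [period R], and a remainder of order
    [2^-1 ^+ n.+1]. *)
Theorem taylor_sum f w : holo f -> exists M : R, forall n,
  rnorm (\sum_(k < n.+1) w ^+ k *: taylor f k - f w) <= M * 2^-1 ^+ n.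
Proof.
move=> fh; have [D Gc] := diff_quot_continuous w fh.
set G := diff_quot f D w in Gc.
have w2 : 0 <= 2 * cabs w by rewrite mulr_ge0 ?cabs_ge0.
(* With [2 * cabs w < 2 ^+ j], the point [w] is inside the contour and [cabs (w / z)] is at most one
   half on it. *)
have [j /(_ j (leqnn _)) jw] := scaled_half_small w2 (@ltr01 R).
have j0 : 0 < 2 ^+ j :> R by rewrite exprn_gt0.
rewrite exprVn ltr_pdivrMr // mul1r in jw.
have [M GM] := continuous_disc_bounded (2 * 2 ^+ j) Gc.
pose r : R[i] := 2 ^+ j.
have r0 : r != 0 by rewrite expf_neq0.
have cr : cabs r = 2 ^+ j by exact: cabs_exp2.
have G0 : contour_sum G r @ \oo --> 0.
  apply: (sqsum_cvg0 (w := w)) => [||_]; last exact: Gc.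
    by rewrite mulf_neq0.
  by move=> z _; exact: diff_quot_derivable.
exists ((cabs (period R))^-1 * (8 * 2 ^+ j * M)) => n.
(* Subtracting the constant changes only the coefficient of index [0], which is where [- f w] in the
   conclusion comes from. *)
pose h z := f z - f w.
have hh : holo h by move=> z; apply: derivableB; [exact: fh|exact: derivable_cst].
pose S m := \sum_(k < n.+1) w ^+ k *: contour_sum (cauchy_kernel h k.+1) r m.
pose rem z := (w / z) ^+ n.+1 *: G z.
have GE m : contour_sum G r m = S m + contour_sum rem r m.
  rewrite /S; under eq_bigr do rewrite -sqsum_scale.
  rewrite -sqsum_sum -sqsumD; apply: eq_sqsum => z zb.
  have z0 : z != 0 by exact: contour_neq0 zb.
  have zw : z != w.
    apply: contraTneq (contour_cabs zb) => ->; rewrite cr negb_and -ltNge.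
    by apply/orP; left; have := cabs_ge0 w; lra.
  rewrite /rem /G /diff_quot (negPf zw) scalerA {1}(inv_sub_geometric n.+1 z0 zw).
  rewrite scalerDl scaler_suml; congr (_ + _).
  by apply: eq_bigr => k _; rewrite /cauchy_kernel scalerA.
have Slim : S @ \oo --> \sum_(k < n.+1) w ^+ k *: contour_int h k.+1.
  rewrite /S; apply: cvg_big => [|k _]; first exact: add_continuous.
  by apply: cvgZl_tmp; exact: contour_int_cvg.
have intE : \sum_(k < n.+1) w ^+ k *: contour_int h k.+1 =
    period R *: (\sum_(k < n.+1) w ^+ k *: taylor f k - f w).
  rewrite scalerBr scaler_sumr.
  have -> : period R *: f w = \sum_(k < n.+1) w ^+ k *: contour_int (fun=> f w) k.+1.
    rewrite big_ord_recl /= big1 ?addr0 => [|k _]; last first.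
      by rewrite contour_int_cst scale0r scaler0.
    by rewrite contour_int_cst expr0 !scale1r.
  rewrite -sumrB; apply: eq_bigr => k _.
  have -> : contour_int h k.+1 = contour_int f k.+1 - contour_int (fun=> f w) k.+1.
    have -> : h = (fun z => -1 *: f w + f z).
      by apply/funext => z; rewrite scaleN1r addrC.
    rewrite (@contour_intP _ _ _ (fun=> f w)) //.
    by rewrite scaleN1r addrC.
  rewrite scalerBr; congr (_ - _).
  by rewrite /taylor !scalerA mulrAC mulfV ?mul1r // period_neq0.
have : rnorm (period R *: (\sum_(k < n.+1) w ^+ k *: taylor f k - f w))
    <= 8 * 2 ^+ j * (2^-1 ^+ n.+1 * M).
  rewrite -intE -[X in rnorm X]subr0.
  have Sv : (fun m => S m - contour_sum G r m) @ \oo -->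
      (\sum_(k < n.+1) w ^+ k *: contour_int h k.+1 - 0) by apply: cvgB.
  apply: cvgn_rnorm_bound Sv _ => m.
  rewrite GE opprD addrA subrr sub0r rnormN -cr.
  apply: contour_sum_le => z; rewrite cr => /andP[rz zr].
  rewrite /rem rnorm_scale cabsX; apply: ler_pM; rewrite ?exprn_ge0 ?cabs_ge0 ?rnorm_ge0//.
    apply: lerXn2r; rewrite ?nnegrE ?cabs_ge0//.
    have z0 : 0 < cabs z by exact: lt_le_trans rz.
    by rewrite cabsM cabsV ler_pdivrMr //; lra.
  exact: GM.
have M0 : 0 <= M by apply: le_trans (rnorm_ge0 _) (GM 0 _); rewrite cabs0; lra.
have p0 : 0 < cabs (period R) by rewrite cabs_gt0 period_neq0.
rewrite rnorm_scale -ler_pdivlMl // => /le_trans; apply.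
rewrite -!mulrA ler_pM2l ?invr_gt0// ler_pM2l // ler_pM2l // mulrC ler_wpM2l //.
by rewrite exprS ler_piMl ?exprn_ge0 //; lra.
Qed.

End Taylor.

(** * Power series *)

Section PowerSeries.
Variables (R : realType) (B : completeNormedModType R[i]).
Implicit Types (u : nat -> B) (t : R^nat) (f : Sigma B) (z w h : R[i]) (k n : nat).

Lemma rnorm_series_cvg u t : (forall k, rnorm (u k) <= t k) ->
  cvgn (series t) -> cvgn (series u).
Proof.
move=> ut /cvg_ex[l tl]; apply: rnorm_cauchy => e e0.
have e2 : 0 < e / 2 by rewrite divr_gt0.
have /cvgrPdist_lt/(_ _ e2)[N _ NP] := tl.
have t0 k : 0 <= t k by exact: le_trans (rnorm_ge0 _) (ut k).
have main n m : (N <= m)%N -> (m <= n)%N -> rnorm (series u n - series u m) <= e.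
  move=> Nm mn; rewrite sub_series_geq //; apply: le_trans (ler_rnorm_sum _ _ _) _.
  apply: (@le_trans _ _ (\sum_(m <= k < n) t k)); first exact: ler_sum.
  rewrite -sub_series_geq //.
  have := NP m Nm; have := NP n (leq_trans Nm mn); rewrite /= !ltr_norml.
  by lra.
exists N => n m Nn Nm; have [mn|nm] := leqP m n; first exact: main.
by rewrite rnormB; apply: main => //; exact: ltnW.
Qed.

Lemma rnorm_series_le u t : (forall k, rnorm (u k) <= t k) ->
  cvgn (series t) -> rnorm (limn (series u)) <= limn (series t).
Proof.
move=> ut ct; apply: (cvgn_rnorm_bound (rnorm_series_cvg ut ct)) => n.
have t0 k : 0 <= t k by exact: le_trans (rnorm_ge0 _) (ut k).
apply: le_trans (ler_rnorm_sum _ _ _) _.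
apply: (@le_trans _ _ (series t n)); first exact: ler_sum.
by apply: nondecreasing_cvgn_le => //; apply: nondecreasing_series.
Qed.

Lemma ex_expR (x : R) : exists n : nat, x <= expR n%:R.
Proof.
exists (Num.truncn x).+1; apply: le_trans (expR_ge1Dx _).
by rewrite ler_wpDl // ltW // truncnS_gt.
Qed.

Lemma l1_termE n (f : nat -> B) k : l1_term n f k = expR n%:R ^+ k * rnorm (f k).
Proof. by rewrite /l1_term natrM expRM_natr. Qed.

Definition psum f z : B := limn (series (fun k => z ^+ k *: f k)).

Lemma psum_term_le n f z k : cabs z <= expR n%:R ->
  rnorm (z ^+ k *: f k) <= l1_term n f k.
Proof.
move=> zn; rewrite l1_termE rnorm_scale cabsX ler_wpM2r ?rnorm_ge0//.
by apply: lerXn2r => //; rewrite nnegrE ?cabs_ge0 ?expR_ge0.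
Qed.

Lemma psum_cvg f z : series (fun k => z ^+ k *: f k) @ \oo --> psum f z.
Proof.
have [n zn] := ex_expR (cabs z).
apply: (rnorm_series_cvg (t := l1_term n f)) => [k|]; [exact: psum_term_le|exact: SigmaP].
Qed.

Lemma psum_le n f z : cabs z <= expR n%:R -> rnorm (psum f z) <= l1_norm n f.
Proof.
move=> zn; apply: (rnorm_series_le (t := l1_term n f)) => [k|]; [exact: psum_term_le|exact: SigmaP].
Qed.

Lemma psumP (a : R[i]) f (g : Sigma B) z :
  psum (a *: f + g) z = a *: psum f z + psum g z.
Proof.
apply: cvg_lim => //.
have -> : series (fun k => z ^+ k *: (a *: f + g : Sigma B) k) =
  (fun n => a *: series (fun k => z ^+ k *: f k) n + series (fun k => z ^+ k *: g k) n).
  apply/funext => n; rewrite /series /= scaler_sumr -big_split; apply: eq_bigr => k _ /=.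
  by rewrite scalerDr !scalerA mulrC.
by apply: cvgD; [apply: cvgZl_tmp|]; exact: psum_cvg.
Qed.

(** The crude constant is enough: geometric growth in [k] is absorbed by an exponentially decreasing
    sequence. At [k = 0] the truncated [k.-1] is harmless, its factor being [0]. *)
Lemma pow_taylor_le (M : R) z h k : cabs z <= M -> cabs (z + h) <= M -> 1 <= M ->
  cabs ((z + h) ^+ k - z ^+ k - h * (k%:R * z ^+ k.-1)) <= cabs h ^+ 2 * (4 * M) ^+ k.
Proof.
move=> zM zhM M1; have M0 : 0 <= M by lra.
have h0 : 0 <= cabs h ^+ 2 by rewrite exprn_ge0 ?cabs_ge0.
elim: k => [|k IH].
  by rewrite !expr0 mul0r mulr0 subrr subr0 cabs0 mulr_ge0.
have -> : (z + h) ^+ k.+1 - z ^+ k.+1 - h * (k.+1%:R * z ^+ k.+1.-1) =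
  (z + h) * ((z + h) ^+ k - z ^+ k - h * (k%:R * z ^+ k.-1)) +
  h ^+ 2 * (k%:R * z ^+ k.-1).
  case: k {IH} => [|k] /=; first by ring.
  by rewrite !exprS -!natr1; ring.
apply: le_trans (ler_cabsD _ _) _.
have kM : cabs (k%:R * z ^+ k.-1) <= (4 * M) ^+ k.
  rewrite cabsM cabs_nat cabsX exprMn; apply: ler_pM; rewrite ?exprn_ge0 ?cabs_ge0//.
    by rewrite -natrX ler_nat ltnW // ltn_expl.
  apply: (@le_trans _ _ (M ^+ k.-1)).
    by apply: lerXn2r; rewrite ?nnegrE ?cabs_ge0.
  by rewrite ler_weXn2l ?leq_pred.
rewrite [in leLHS]cabsM [X in _ + X]cabsM cabsX.
have q0 : 0 <= cabs h ^+ 2 * (4 * M) ^+ k by rewrite mulr_ge0 // exprn_ge0 // mulr_ge0.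
have -> : cabs h ^+ 2 * (4 * M) ^+ k.+1 = 4 * M * (cabs h ^+ 2 * (4 * M) ^+ k).
  by rewrite (exprS _ k); ring.
apply: (@le_trans _ _ (M * (cabs h ^+ 2 * (4 * M) ^+ k) + cabs h ^+ 2 * (4 * M) ^+ k)).
  apply: lerD; last by rewrite ler_wpM2l.
  by apply: ler_pM; rewrite ?cabs_ge0.
by rewrite -[X in _ + X]mul1r -mulrDl ler_wpM2r //; lra.
Qed.

Lemma derivable_of_bound (g : R[i]^o -> B) (z : R[i]^o) (D : B) (L : R) :
  (forall h, cabs h <= 1 -> rnorm (g (h + z) - g z - h *: D) <= cabs h ^+ 2 * L) ->
  derivable g z 1.
Proof.
(* The bound at [h = 1] shows that [L] is nonnegative. *)
move=> gL; have L0 : 0 <= L.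
  by have := gL 1; rewrite cabs1 expr1n mul1r => /(_ (lexx _)); apply: le_trans (rnorm_ge0 _).
apply/cvg_ex; exists D; apply/cvg_rnorm => e e0.
rewrite near_withinE; apply/nbhs_cabs.
exists (Num.min 1 (e / (L + 1))).
  by rewrite lt_min ltr01 divr_gt0 // ltr_wpDl.
move=> h; rewrite subr0 lt_min => /andP[h1 hL] h0 /=.
rewrite -[_ *: 1]/(_ * 1) mulr1.
have hp : 0 < cabs h by rewrite cabs_gt0.
have -> : h^-1 *: (g (h + z) - g z) - D = h^-1 *: (g (h + z) - g z - h *: D).
  by rewrite [RHS]scalerBr scalerA mulVf ?scale1r.
rewrite rnorm_scale cabsV ltr_pdivrMl //.
apply: le_lt_trans (gL _ (ltW h1)) _; rewrite expr2 -mulrA ltr_pM2l //.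
rewrite ltr_pdivlMr ?ltr_wpDl// in hL; apply: le_lt_trans hL.
by rewrite ler_wpM2l ?cabs_ge0// lerDl.
Qed.

(** Termwise differentiation: by [pow_taylor_le] the remainders of all terms add up to at most
    [cabs h ^+ 2 * l1_norm n f], once [expR n%:R] exceeds [4 * M]. *)
Lemma psum_holo f : holo (psum f).
Proof.
move=> z; pose M := cabs z + 1; have z0 := cabs_ge0 z.
have M1 : 1 <= M by rewrite /M; lra.
have [n nM] := ex_expR (4 * M).
have dterm k : rnorm ((k%:R * z ^+ k.-1) *: f k) <= l1_term n f k.
  rewrite rnorm_scale l1_termE ler_wpM2r ?rnorm_ge0//.
  rewrite cabsM cabs_nat cabsX.
  apply: (@le_trans _ _ ((4 * M) ^+ k)).
    rewrite exprMn; apply: ler_pM; rewrite ?exprn_ge0 ?cabs_ge0//.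
      by rewrite -natrX ler_nat ltnW // ltn_expl.
    apply: (@le_trans _ _ (M ^+ k.-1)).
      by apply: lerXn2r; rewrite ?nnegrE ?cabs_ge0 /M; lra.
    by rewrite ler_weXn2l ?leq_pred.
  by apply: lerXn2r; rewrite ?nnegrE ?expR_ge0 ?mulr_ge0 // /M; lra.
have Dcvg := rnorm_series_cvg dterm (@SigmaP _ _ f n).
apply: (@derivable_of_bound _ _ (limn (series (fun k => (k%:R * z ^+ k.-1) *: f k)))
  (l1_norm n f)) => h h1.
have lim_all := cvgB (cvgB (@psum_cvg f (h + z)) (@psum_cvg f z)) (cvgZl_tmp (k := h) Dcvg).
apply: (cvgn_rnorm_bound (lim_all _ _ _)) => m.
have -> : (series (fun k => (h + z) ^+ k *: f k) - series (fun k => z ^+ k *: f k) -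
    h \*: series (fun k => (k%:R * z ^+ k.-1) *: f k)) m =
  \sum_(0 <= k < m) ((z + h) ^+ k - z ^+ k - h * (k%:R * z ^+ k.-1)) *: f k.
  rewrite /series /= -![(_ - _ : _ -> _) _]/(_ - _) /= scaler_sumr -!sumrB.
  by apply: eq_bigr => k _; rewrite !scalerBl scalerA (addrC h).
apply: le_trans (ler_rnorm_sum _ _ _) _.
apply: (@le_trans _ _ (\sum_(0 <= k < m) cabs h ^+ 2 * l1_term n f k)).
  apply: ler_sum => k _; rewrite rnorm_scale l1_termE [leRHS]mulrA ler_wpM2r ?rnorm_ge0//.
  apply: le_trans (@pow_taylor_le M z h k _ _ M1) _.
  - by rewrite /M lerDl.
  - by apply: le_trans (ler_cabsD _ _) _; rewrite lerD2l.
  rewrite ler_wpM2l ?exprn_ge0 ?cabs_ge0//.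
  by apply: lerXn2r; rewrite ?nnegrE ?expR_ge0 ?mulr_ge0 // /M; lra.
rewrite -mulr_sumr ler_wpM2l ?exprn_ge0 ?cabs_ge0//.
apply: (@nondecreasing_cvgn_le _ (series (l1_term n f))); last exact: SigmaP.
by apply: nondecreasing_series => k _ _; exact: l1_term_ge0.
Qed.

(** At a small real [x], the terms before [m] vanish by induction and those after [m] total at most
    [x ^+ m.+1 * L]. Dividing by [x ^+ m] bounds [f m] by [x * L]. *)
Lemma psum_inj f : (forall w, psum f w = 0) -> forall m, f m = 0.
Proof.
move=> f0; elim/ltn_ind => m IH.
pose L := l1_norm 0 f.
have L0 : 0 <= L by apply: le_trans (rnorm_ge0 _) (@psum_le 0 f 0 _); rewrite cabs0 expR_ge0.
have key (x : R) : 0 < x <= 1 -> rnorm (f m) <= x * L.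
  move=> /andP[x0 x1]; pose w : R[i] := x%:C%C.
  have cw : cabs w = x by apply/cabsC/ltW.
  have part n : (m < n)%N ->
      rnorm (series (fun k => w ^+ k *: f k) n - w ^+ m *: f m) <= x ^+ m.+1 * L.
    move=> mn; rewrite /series /= (bigD1_seq m) ?mem_index_iota ?iota_uniq //=.
    rewrite addrAC subrr add0r; apply: le_trans (ler_rnorm_sum _ _ _) _.
    apply: (@le_trans _ _ (\sum_(0 <= k < n | k != m) x ^+ m.+1 * l1_term 0 f k)).
      apply: ler_sum => k km; rewrite rnorm_scale cabsX cw l1_termE expR0 expr1n mul1r.
      have [lt_km|] := ltnP k m; first by rewrite IH // rnorm0 !mulr0.
      rewrite leq_eqVlt eq_sym (negPf km) /= => lt_mk.
      by rewrite ler_wpM2r ?rnorm_ge0// ler_wiXn2l // ltW.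
    rewrite -mulr_sumr ler_wpM2l ?exprn_ge0 ?(ltW x0)//.
    apply: (@le_trans _ _ (series (l1_term 0 f) n)).
      by rewrite /series /= [leRHS](bigID (fun k => k != m)) /= lerDl sumr_ge0 // => k _; exact: l1_term_ge0.
    apply: nondecreasing_cvgn_le; last exact: SigmaP.
    by apply: nondecreasing_series => k _ _; exact: l1_term_ge0.
  have := cvgn_rnorm_le (@psum_cvg f w) part.
  rewrite f0 sub0r rnormN rnorm_scale cabsX cw exprSr -mulrA.
  by rewrite ler_pM2l ?exprn_gt0.
apply: rnorm_small => e e0.
apply: (le_trans (key (Num.min 1 (e / (L + 1))) _)).
  by rewrite ge_min lexx lt_min ltr01 divr_gt0 // ltr_wpDl.
apply: (@le_trans _ _ (e / (L + 1) * L)); first by rewrite ler_wpM2r // ge_min lexx orbT.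
rewrite mulrAC -mulrA; rewrite ler_piMr ?(ltW e0)// ler_pdivrMr ?ltr_wpDl//.
by rewrite mul1r lerDl.
Qed.

End PowerSeries.

(** * The isomorphism *)

Section Isomorphism.
Variables (R : realType) (B : completeNormedModType R[i]).
Implicit Types (f : Sigma B) (h : Hol B) (z w : R[i]) (k n j : nat).

Lemma Hol_holo h : holo h.
Proof. exact: (set_mem (Hol_in h)). Qed.

Lemma psum_in f : psum f \in @holomorphic R B.
Proof. exact/mem_set/psum_holo. Qed.

Definition to_Hol f : Hol B := MkHol (psum_in f).

Lemma HolP h h' : (forall z, h z = h' z) -> h = h'.
Proof. by move=> hh; apply/val_inj/funext. Qed.

Lemma to_Hol_linear : linear to_Hol.
Proof. by move=> a f g; apply: HolP => z; exact: psumP. Qed.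

HB.instance Definition _ :=
  GRing.isLinear.Build R[i] (Sigma B) (Hol B) *:%R to_Hol to_Hol_linear.

(** Since [2 ^+ j] is at least twice [expR n%:R], Cauchy's estimate dominates the weighted terms by
    a geometric series of ratio one half; its sum doubles the constant [8]. *)
Lemma taylor_l1_le (g : R[i] -> B) n j (M : R) : holo g ->
  2 * expR n%:R <= 2 ^+ j :> R ->
  (forall z, cabs z <= 2 ^+ j.+1 -> rnorm (g z) <= M) ->
  cvgn (series (l1_term n (taylor g))) /\
  l1_norm n (taylor g) <= 16 / cabs (period R) * M.
Proof.
move=> gh nj gM; set c := 8 / cabs (period R) * M.
have j0 : 0 < 2 ^+ j :> R by rewrite exprn_gt0.
have h1 : `|2^-1| < 1 :> R by rewrite ger0_norm //; lra.
have M0 : 0 <= M.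
  by apply: le_trans (rnorm_ge0 _) (gM 0 _); rewrite cabs0 exprn_ge0.
have c0 : 0 <= c by rewrite /c !mulr_ge0 // invr_ge0 cabs_ge0.
have term k : l1_term n (taylor g) k <= geometric c 2^-1 k.
  rewrite l1_termE /= mulrC.
  apply: (le_trans (ler_wpM2r _ (taylor_le k gh gM))); first by rewrite exprn_ge0 ?expR_ge0.
  rewrite -/c -mulrA ler_wpM2l // -exprMn; apply: lerXn2r; rewrite ?nnegrE //.
  by rewrite ler_pdivrMl //; lra.
have ct : cvgn (series (l1_term n (taylor g))).
  apply: series_le_cvg term _; first exact: l1_term_ge0.
    by move=> k; rewrite /= mulr_ge0 ?exprn_ge0.
  exact: is_cvg_geometric_series.
split=> //; have := @lim_series_le R _ _ ct (is_cvg_geometric_series (a := c) h1) term.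
move/le_trans; apply.
rewrite (cvg_lim _ (cvg_geometric_series (a := c) h1)) // /c le_eqVlt; apply/orP; left; apply/eqP.
have p0 : cabs (period R) != 0 by rewrite cabs_eq0 period_neq0.
by field; rewrite p0.
Qed.

Lemma ex_exp2 (x : R) : exists j, x <= 2 ^+ j.
Proof.
exists (Num.truncn x).+1; apply: le_trans (ltW (truncnS_gt _)) _.
by rewrite -natrX ler_nat ltnW // ltn_expl.
Qed.

Lemma taylor_in h : taylor h \in @exp_decreasing R B.
Proof.
apply/mem_set => n; have [j nj] := ex_exp2 (2 * expR n%:R).
have [z|M hM] := @continuous_disc_bounded _ _ h (2 ^+ j.+1).
  exact/derivable_continuous/Hol_holo.
by have [] := taylor_l1_le (@Hol_holo h) nj hM.
Qed.

Definition to_Sigma h : Sigma B := MkSigma (taylor_in h).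

Lemma SigmaE f f' : (forall k, f k = f' k) -> f = f'.
Proof. by move=> ff; apply/val_inj/funext. Qed.

Lemma to_Sigma_linear : linear to_Sigma.
Proof.
by move=> a h h'; apply: SigmaE => k; apply: taylorP; exact: Hol_holo.
Qed.

HB.instance Definition _ :=
  GRing.isLinear.Build R[i] (Hol B) (Sigma B) *:%R to_Sigma to_Sigma_linear.

Lemma to_SigmaK : cancel to_Sigma to_Hol.
Proof.
move=> h; apply: HolP => w; have [M wM] := taylor_sum w (@Hol_holo h).
(* The shift matches the [n.+1] terms of the partial sums in [taylor_sum]. *)
apply: cvg_lim => //; rewrite -cvg_shiftS; apply/cvg_rnorm => e e0.
have M0 : 0 <= M by have := wM 0; rewrite expr0 mulr1; apply: le_trans (rnorm_ge0 _).
have [N NP] := scaled_half_small M0 e0.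
exists N => // n /NP; apply: le_lt_trans.
by rewrite /series /= big_mkord; exact: wM.
Qed.

(** A right inverse of an injective map is also a left inverse; injectivity is [psum_inj]. *)
Lemma to_HolK : cancel to_Hol to_Sigma.
Proof.
move=> f; apply/eqP; rewrite -subr_eq0; apply/eqP; apply: SigmaE; apply: psum_inj => w.
have : to_Hol (to_Sigma (to_Hol f) - f) = 0 by rewrite linearB /= to_SigmaK subrr.
by move=> /(congr1 (fun h : Hol B => h w)).
Qed.

Lemma to_Hol_continuous : continuous to_Hol.
Proof.
apply: continuous_comp_initial => f.
have FF : Filter (@Hol_fun R B \o to_Hol @ f) by apply: fmap_filter; apply: (nbhs_filter f).
apply: (@fam_cvgP _ _ compact (@Hol_fun R B \o to_Hol @ f) (to_Hol f) FF).2.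
move=> K cK P /uniform_nbhs[E [entE EP]].
(* [K] lies in the disc of radius [expR n%:R], where [psum_le] bounds the difference by the single
   norm [l1_norm n]. *)
have [M KM] := compact_disc_sub cK; have [n Mn] := ex_expR M.
move: entE; rewrite -entourage_ballE => -[e /= e0 eE].
have e0' : 0 < complex.Re e by move: e0; rewrite ltcE => /andP[].
exists (n, complex.Re e) => // g gf; apply: EP => z Kz; apply: eE => /=.
rewrite -ball_normE /= rnormE -[ltRHS]RRe_real ?gtr0_real// ltcR rnormB.
have -> : psum g z - psum f z = psum (g - f) z.
  by rewrite addrC -scaleN1r -psumP scaleN1r addrC.
apply: le_lt_trans gf; apply: psum_le; exact: le_trans (KM _ Kz) Mn.
Qed.

Lemma to_Sigma_continuous : continuous to_Sigma.
Proof.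
move=> h A [[n e] /= e0 hA]; have [j nj] := ex_exp2 (2 * expR n%:R).
pose K := [set z : R[i]^o | cabs z <= 2 ^+ j.+1].
have p0 : 0 < cabs (period R) by rewrite cabs_gt0 period_neq0.
(* Twice the constant [16] of [taylor_l1_le], so that the final bound is [e / 2] and the inequality
   strict. *)
pose d := e / (32 / cabs (period R)).
have d0 : 0 < d by rewrite divr_gt0 // divr_gt0.
have d0' : 0 < d%:C%C by rewrite ltcR.
have cont := @initial_continuous _ _ (@Hol_fun R B : Hol B -> {family compact, R[i]^o -> B}) h.
have near_h : nbhs (Hol_fun h : {family compact, R[i]^o -> B})
    [set g | forall z, K z -> rnorm (g z - h z) <= d].
  have := @fam_nbhs _ _ compact K _ (h : {family compact, R[i]^o -> B})
    (entourage_ball B (PosNum d0')) (@compact_disc R (2 ^+ j.+1)).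
  apply: filterS => g gd z Kz; have := gd z Kz.
  by rewrite /= -ball_normE /= rnormE ltcR rnormB => /ltW.
apply: (@filterS _ (nbhs h) (nbhs_filter h) _ _ _ (cont _ near_h)) => g gd; apply: hA.
change (l1_norm n (to_Sigma g - to_Sigma h : Sigma B) < e).
rewrite -linearB.
have [_] := @taylor_l1_le (g - h : Hol B) n j d (@Hol_holo (g - h)) nj gd.
move/le_lt_trans; apply; rewrite /d.
have -> : 16 / cabs (period R) * (e / (32 / cabs (period R))) = e / 2.
  by field; rewrite gt_eqF.
by rewrite ltr_pdivrMr // ltr_pMr // ltrDl.
Qed.

End Isomorphism.

Theorem lemma2p12 (R : realType) (B : completeNormedModType R[i]) :
  linear_homeomorphic (Sigma B) (Hol B).
Proof.
exists (@to_Hol R B : {linear _ -> _}), (@to_Sigma R B : {linear _ -> _}).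
split; [exact: to_HolK|exact: to_SigmaK|exact: to_Hol_continuous|exact: to_Sigma_continuous].
Qed.
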